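(* Let $\gamma=\mathcal{N}(0,I_d)$. If $\tilde I(\gamma,p_R)=0$ for almost every orthogonal matrix $R\in\mathbb{R}^{d\times d}$ (with respect to the Haar measure on the orthogonal group), then $p=\gamma$.
   Context: Standing assumptions: $p(\mathbf{x})\propto \exp(-U(\mathbf{x}))$ is a positive, continuously differentiable probability density on $\mathbb{R}^d$, and there exist $c>0$, $m\ge 2$ with $|\log p(\mathbf{x})|\le c(1+\|\mathbf{x}\|_2^m)$ and $\|\nabla\log p(\mathbf{x})\|_2\le c(1+\|\mathbf{x}\|_2^m)$ for a.e. $\mathbf{x}$. For an orthogonal $R$, $p_R$ denotes the density of $RX$ for $X\sim p$, i.e. $p_R(\mathbf{x})=p(R^\top\mathbf{x})$. For a product density $q$, $\mathbb{E}_{q_{-i}}[f(\mathbf{x})]$ denotes the expectation over all coordinates other than $x_i$ under $q$ (a function of $x_i$). The projected Fisher information is $$\tilde I(q,p)=\sum_{i=1}^d \mathbb{E}_{q}\Big[\Big(\mathbb{E}_{q_{-i}}\big[\partial_i\log q(\mathbf{x})-\partial_i\log p(\mathbf{x})\big]\Big)^2\Big].$$ *)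

(* Defs.v *)
From HB Require Import structures.
From mathcomp Require Import all_boot all_order all_algebra.
From mathcomp Require Import all_classical all_reals all_analysis.
Import Order.TTheory GRing.Theory Num.Theory.

Set Implicit Arguments.
Unset Strict Implicit.
Unset Printing Implicit Defensive.

Local Open Scope classical_set_scope.
Local Open Scope ring_scope.

Section Defs.
Variable R : realType.

(* Iterated integral over R^n of f : R^n -> \bar R with respect to the
   product of n copies of the measure  w(t) dt  (dt = Lebesgue measure on R).
   Coordinates are split as x = (x_0, x_1..x_{n-1}).  For nonnegative
   measurable f this is the integral w.r.t. the product measure (Tonelli);
   for integrable f it is that integral as well (Fubini). *)
Fixpoint wint (w : R -> R) (n : nat) : ('rV[R]_n -> \bar R) -> \bar R :=
  match n with
  | 0 => fun f => f 0
  | n'.+1 => fun f =>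
      (\int[@lebesgue_measure R]_t
         ((w t)%:E * wint w (fun y : 'rV[R]_n' =>
                                f (row_mx (const_mx t : 'rV[R]_1) y))))%E
  end.

Definition leb_int (n : nat) (f : 'rV[R]_n -> \bar R) : \bar R :=
  wint (fun _ => 1) f.

Definition leb_ae (n : nat) (P : 'rV[R]_n -> Prop) : Prop :=
  leb_int (fun x => (\1_(~` [set y | P y]) x : R)%:E) = 0%E.

Definition gauss_exp (n : nat) (f : 'rV[R]_n -> \bar R) : \bar R :=
  wint (normal_pdf 0 1) f.

Definition sqnorm (n : nat) (x : 'rV[R]_n) : R := \sum_(i < n) x ord0 i ^+ 2.
Definition enorm (n : nat) (x : 'rV[R]_n) : R := Num.sqrt (sqnorm x).

Definition gauss_dens (n : nat) (x : 'rV[R]_n) : R :=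
  (Num.sqrt (pi *+ 2) ^+ n)^-1 * expR (- (sqnorm x / 2)).

Definition orth_mx (n : nat) (M : 'M[R]_(n, n)) : Prop :=
  M^T *m M = 1%:M.

(* p_R(x) = p(R^T x): in row-vector convention R^T x corresponds to x *m R. *)
Definition rot_dens (n : nat) (p : 'rV[R]_n -> R) (M : 'M[R]_(n, n))
  : 'rV[R]_n -> R := fun x => p (x *m M).

Definition pd (n : nat) (i : 'I_n) (f : 'rV[R]_n -> R) (x : 'rV[R]_n) : R :=
  'D_(delta_mx 0 i) f x.

Definition grad (n : nat) (f : 'rV[R]_n -> R) (x : 'rV[R]_n) : 'rV[R]_n :=
  \row_i pd i f x.

Definition setc (n : nat) (x : 'rV[R]_n) (i : 'I_n) (t : R) : 'rV[R]_n :=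
  \row_j (if j == i then t else x ord0 j).

(* tI(gamma, p) = sum_i E_gamma[ ( E_{gamma_{-i}}[ d_i log gamma - d_i log p ] )^2 ].
   The inner expectation over all coordinates except x_i is computed as the
   gamma-expectation in y of the integrand evaluated at y with its i-th
   coordinate replaced by x_i (the integrand then does not depend on y_i). *)
Definition proj_fisher_gauss (n : nat) (p : 'rV[R]_n -> R) : \bar R :=
  (\sum_(i < n)
     gauss_exp (fun x : 'rV[R]_n =>
       let h := gauss_exp (fun y : 'rV[R]_n =>
                  (pd i (fun z => ln (gauss_dens z)) (setc y i (x ord0 i))
                   - pd i (fun z => ln (p z)) (setc y i (x ord0 i)))%:E) in
       h * h))%E.

Definition Mpt (n : nat) : pointedType := ('M[R]_(n, n) : normedModType R).
Definition borelM (n : nat) : set (set (Mpt n)) :=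
  @open ('M[R]_(n, n) : normedModType R).
Definition MBorel (n : nat) := g_sigma_algebraType (@borelM n).

(* mu is the (normalized) Haar measure of the orth_mx group O(n), seen as a
   Borel measure on matrices concentrated on O(n): a left-invariant Borel
   probability measure on the compact group O(n) (unique). *)
Definition is_haar_On (n : nat) (mu : {measure set (MBorel n) -> \bar R}) : Prop :=
  [/\ mu setT = 1%E,
      mu [set M : MBorel n | ~ orth_mx M] = 0%E &
      forall Q : 'M[R]_(n, n), orth_mx Q ->
        forall A : set (MBorel n), measurable A ->
          mu ((fun M : MBorel n => (Q *m M : MBorel n)) @^-1` A) = mu A].

End Defs.

(* Main.v *)
Require Import Defs.
From HB Require Import structures.
From mathcomp Require Import all_boot all_order all_algebra.
From mathcomp Require Import all_classical all_reals all_analysis.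
From mathcomp Require Import measurable_realfun ring lra.
Import Order.TTheory GRing.Theory Num.Theory.
Import numFieldNormedType.Exports.
Local Open Scope classical_set_scope.
Local Open Scope ring_scope.
Set Implicit Arguments.
Unset Strict Implicit.
Unset Printing Implicit Defensive.

(* Put g = log p - log gamma; the goal is that g is constant. For an orthogonal M
   with first row u, the vanishing of the first summand of the projected Fisher
   information says that the mean of the directional derivative of g along u, over
   the hyperplane <x, u> = t weighted by gamma, is zero for every t. Hence
   E[g(X) | <X, u> = t] does not depend on t, and with c = E[g(X)],
     E[(g(X) - c) phi(<X, u>)] = 0   for every test function phi.
   Haar-almost every M qualifies, so the admissible u are dense in the sphere, and
   by continuity E[(g(X) - c) cos(<X, w> + b)] = 0 for all w and b. Products of
   cosines are combinations of such functions, and cos(y/sqrt k)^k tends to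
   exp(-y^2/2); so (g - c) gamma integrates to zero against every Gaussian bump
   exp(-q^2 |x - a|^2 / 2), and letting q go to infinity gives g(a) = c. *)

Lemma nbhs_continuous_gt (R : realType) (T : topologicalType) (f : T -> R) x c :
  continuous f -> c < f x -> \forall y \near x, c < f y.
Proof. by move=> cf; apply: cvgr_gt; exact: cf. Qed.

Lemma closed_le_continuous (R : realType) (T : topologicalType) (f g : T -> R) :
  continuous f -> continuous g -> closed [set x | f x <= g x].
Proof.
move=> cf cg.
have -> : [set x | f x <= g x] = (fun x => f x - g x) @^-1` [set t | t <= 0].
  by apply/seteqP; split=> x /=; rewrite subr_le0.
apply: closed_comp => [x _|]; last exact: closed_le.
by apply: continuousB; [exact: cf|exact: cg].
Qed.

Lemma closure_sequence (R : realType) (V : pseudoMetricType R) (A : set V) x :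
  closure A x ->
  exists2 u : nat -> V, (forall k, A (u k)) & u k @[k --> \oo] --> x.
Proof.
move=> Ax.
have /choice[u uP] (k : nat) : exists y, A y /\ ball x k.+1%:R^-1 y.
  have [|y [Ay xy]] := Ax (ball x k.+1%:R^-1); last by exists y.
  by apply: nbhsx_ballx; rewrite invr_gt0.
exists u => [k|]; first by have [] := uP k.
apply/cvg_ballP => e e0; near=> k; have [_] := uP k; apply: le_ball.
by apply: ltW; near: k; exact: near_infty_natSinv_lt (PosNum e0).
Unshelve. all: by end_near. Qed.

Lemma cvgn_cst_eq (R : realType) (a b : R) :
  (fun _ : nat => a) k @[k --> \oo] --> b -> b = a.
Proof. by move=> a_cvg; have := cvg_unique _ a_cvg (cvg_cst a); exact. Qed.

Section RowVectors.
Variable R : realType.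

Lemma cvg_mx (m n : nat) (T : Type) {F : set_system T} {FF : Filter F}
    (f : T -> 'M[R]_(m, n)) (l : 'M[R]_(m, n)) :
  (forall i j, f x i j @[x --> F] --> l i j) -> f x @[x --> F] --> l.
Proof.
move=> fl A [P lP PA]; rewrite /= /nbhs /=.
have : F (fun x => forall ij : 'I_m * 'I_n, P ij.1 ij.2 (f x ij.1 ij.2)).
  by apply: filter_forall => -[i j] /=; exact: fl.
by apply: filterS => x Px; apply: PA => i j; exact: (Px (i, j)).
Qed.

Lemma cvg_mx_coord (m n : nat) (T : Type) {F : set_system T} {FF : Filter F}
    (f : T -> 'M[R]_(m, n)) (l : 'M[R]_(m, n)) i j :
  f x @[x --> F] --> l -> f x i j @[x --> F] --> l i j.
Proof.
move=> fl; apply: (@continuous_cvg _ _ _ _ _ f (fun M => M i j)) => //;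
  exact: coord_continuous.
Qed.

Lemma continuous_mx (m n : nat) (T : topologicalType) (f : T -> 'M[R]_(m, n)) :
  (forall i j, continuous (fun x => f x i j)) -> continuous f.
Proof. by move=> cf x; apply: cvg_mx => i j; exact: cf. Qed.

Lemma continuous_mulmx (m n p : nat) (T : topologicalType)
    (f : T -> 'M[R]_(m, n)) (g : T -> 'M[R]_(n, p)) :
  continuous f -> continuous g -> continuous (fun x => f x *m g x).
Proof.
move=> cf cg; apply: continuous_mx => i j; under eq_fun do rewrite mxE.
apply: continuous_big => [|k _ x]; first exact: add_continuous.
by apply: continuousM; apply: cvg_mx_coord; [exact: cf|exact: cg].
Qed.

Lemma continuous_translate (m n : nat) (v : 'M[R]_(m, n)) :
  continuous (fun x : 'M[R]_(m, n) => x + v).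
Proof.
apply: continuous_mx => i j x; under eq_fun do rewrite mxE.
by apply: continuousD; [exact: coord_continuous|exact: cst_continuous].
Qed.

Lemma continuous_affine (m n p : nat) (A : 'M[R]_(n, p)) (v : 'M[R]_(m, p)) :
  continuous (fun x : 'M[R]_(m, n) => x *m A + v).
Proof.
have cA : continuous (fun x : 'M[R]_(m, n) => x *m A).
  by apply: continuous_mulmx => x; [exact: cvg_id|exact: cst_continuous].
by move=> x; exact: (continuous_comp (cA x) (@continuous_translate _ _ v _)).
Qed.

(* Convertible to the splitting of coordinates in wint. *)
Definition row_cons (n : nat) (t : R) (y : 'rV[R]_n) : 'rV[R]_n.+1 :=
  row_mx (const_mx t : 'rV[R]_1) y.

Lemma row_cons0 n t (y : 'rV[R]_n) : row_cons t y 0 ord0 = t.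
Proof.
rewrite /row_cons (_ : ord0 = lshift n (ord0 : 'I_1)); last exact/val_inj.
by apply: etrans (row_mxEl _ _ _ _) _; rewrite mxE.
Qed.

Lemma row_consS n t (y : 'rV[R]_n) j : row_cons t y 0 (lift ord0 j) = y 0 j.
Proof.
rewrite /row_cons (_ : lift ord0 j = rshift 1 j); last exact/val_inj.
exact: row_mxEr.
Qed.

Lemma row_consK n t (y : 'rV[R]_n) : col' ord0 (row_cons t y) = y.
Proof. by apply/rowP => j; rewrite mxE row_consS. Qed.

Lemma row_cons_eta n (x : 'rV[R]_n.+1) : row_cons (x 0 ord0) (col' ord0 x) = x.
Proof.
apply/rowP => i; case: (unliftP ord0 i) => [j|] ->; last by rewrite row_cons0.
by rewrite row_consS mxE.
Qed.

Lemma row_consD n s t (y z : 'rV[R]_n) :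
  row_cons s y + row_cons t z = row_cons (s + t) (y + z).
Proof.
apply/rowP => i; rewrite mxE.
by case: (unliftP ord0 i) => [j|] ->; rewrite ?row_cons0// !row_consS mxE.
Qed.

Lemma cvg_row_cons n (T : Type) {F : set_system T} {FF : Filter F}
    (s : T -> R) (t : R) (f : T -> 'rV[R]_n) (y : 'rV[R]_n) :
  s x @[x --> F] --> t -> f x @[x --> F] --> y ->
  row_cons (s x) (f x) @[x --> F] --> row_cons t y.
Proof.
move=> st fy; apply: cvg_mx => i j; rewrite ord1.
case: (unliftP ord0 j) => [k|] ->.
  by rewrite row_consS; under eq_fun do rewrite row_consS; exact: cvg_mx_coord.
by rewrite row_cons0; under eq_fun do rewrite row_cons0.
Qed.

Lemma continuous_row_cons n t : continuous (@row_cons n t).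
Proof.
by move=> y; apply: (@cvg_row_cons _ _ (nbhs y));
  [exact: cvg_cst|exact: cvg_id].
Qed.

Lemma continuous_row_consl n (y : 'rV[R]_n) :
  continuous (fun t => row_cons t y).
Proof.
by move=> t; apply: (@cvg_row_cons _ _ (nbhs t));
  [exact: cvg_id|exact: cvg_cst].
Qed.

Lemma sqnorm_row_cons n t (y : 'rV[R]_n) :
  sqnorm (row_cons t y) = t ^+ 2 + sqnorm y.
Proof.
rewrite /sqnorm big_ord_recl row_cons0; congr (_ + _).
by apply: eq_bigr => i _; rewrite row_consS.
Qed.

Lemma sqnorm_ge0 n (x : 'rV[R]_n) : 0 <= sqnorm x.
Proof. by apply: sumr_ge0 => i _; exact: sqr_ge0. Qed.

Lemma sqnorm_rV0 (x : 'rV[R]_0) : sqnorm x = 0.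
Proof. by rewrite /sqnorm big_ord0. Qed.

Lemma sqnormZ n (c : R) (x : 'rV[R]_n) : sqnorm (c *: x) = c ^+ 2 * sqnorm x.
Proof.
by rewrite /sqnorm mulr_sumr; apply: eq_bigr => i _; rewrite mxE exprMn.
Qed.

Lemma sqnormB_le n (x v : 'rV[R]_n) :
  sqnorm (x - v) <= 2 * (sqnorm x + sqnorm v).
Proof.
rewrite /sqnorm -big_split/= mulr_sumr; apply: ler_sum => i _; rewrite !mxE.
have := sqr_ge0 (x ord0 i + v ord0 i); nra.
Qed.

Lemma continuous_sqnorm n : continuous (@sqnorm R n).
Proof.
apply: continuous_big => [|i _ x]; first exact: add_continuous.
by apply: (@continuous_comp _ _ _ _ (fun t : R => t ^+ 2));
  [exact: coord_continuous|exact: exprn_continuous].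
Qed.

Lemma sqr_enorm n (x : 'rV[R]_n) : enorm x ^+ 2 = sqnorm x.
Proof. by rewrite sqr_sqrtr// sqnorm_ge0. Qed.

Lemma enorm_ge0 n (x : 'rV[R]_n) : 0 <= enorm x.
Proof. exact: sqrtr_ge0. Qed.

Lemma coord_le_enorm n (x : 'rV[R]_n) i : `|x 0 i| <= enorm x.
Proof.
rewrite -(@ler_sqr _ `|_|) ?nnegrE ?enorm_ge0// sqr_enorm real_normK
  ?num_real//.
by rewrite /sqnorm (bigD1 i)//= lerDl sumr_ge0// => k _; exact: sqr_ge0.
Qed.

Lemma continuous_enorm n : continuous (@enorm R n).
Proof.
by move=> x; apply: continuous_comp;
  [exact: continuous_sqnorm|exact: sqrt_continuous].
Qed.

Lemma sqnorm_mulmx_le n (A : 'M[R]_n) : exists2 K, 0 < K &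
  forall x, sqnorm (x *m A) <= K * sqnorm x.
Proof.
exists (1 + \sum_j (\sum_i `|A i j|) ^+ 2).
  by rewrite ltr_wpDr// sumr_ge0// => j _; exact: sqr_ge0.
move=> x; rewrite mulrDl mul1r -[leLHS]add0r lerD ?sqnorm_ge0// mulr_suml.
apply: ler_sum => j _; rewrite -sqr_enorm -exprMn mxE.
rewrite -real_normK ?num_real// lerXn2r ?nnegrE ?mulr_ge0 ?enorm_ge0
  ?sumr_ge0//.
apply: (le_trans (ler_norm_sum _ _ _)); rewrite mulr_suml.
by apply: ler_sum => i _; rewrite normrM mulrC ler_wpM2l// coord_le_enorm.
Qed.

Definition dot (n : nat) (x w : 'rV[R]_n) : R := (x *m w^T) 0 0.

Lemma dotDr n (x w v : 'rV[R]_n) : dot x (w + v) = dot x w + dot x v.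
Proof. by rewrite /dot linearD mulmxDr mxE. Qed.

Lemma dotZr n (x w : 'rV[R]_n) s : dot x (s *: w) = s * dot x w.
Proof. by rewrite /dot linearZ -scalemxAr mxE. Qed.

Lemma dotNr n (x w : 'rV[R]_n) : dot x (- w) = - dot x w.
Proof. by rewrite -scaleN1r dotZr mulN1r. Qed.

Lemma dot_delta n (x : 'rV[R]_n) j : dot x (delta_mx 0 j) = x 0 j.
Proof. by rewrite /dot trmx_delta -colE mxE. Qed.

Lemma dotC n (x v : 'rV[R]_n) : dot x v = dot v x.
Proof. by rewrite /dot -[x in LHS]trmxK -trmx_mul mxE. Qed.

Lemma continuous_dot n (w : 'rV[R]_n) : continuous (fun x => dot x w).
Proof.
move=> x; apply: (@cvg_mx_coord _ _ _ (nbhs x) _ (fun x => x *m w^T)).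
by apply: (@continuous_mulmx _ _ _ _ id (fun=> w^T)) => y;
  [exact: cvg_id|exact: cst_continuous].
Qed.

Lemma sqnormE n (x : 'rV[R]_n) : sqnorm x = dot x x.
Proof. by rewrite /dot mxE; apply: eq_bigr => i _; rewrite mxE expr2. Qed.

Lemma sqnorm_eq0 n (x : 'rV[R]_n) : sqnorm x = 0 -> x = 0.
Proof.
move=> x0; apply/rowP => i; apply/eqP; rewrite mxE -normr_le0.
by rewrite (le_trans (coord_le_enorm x i))// /enorm x0 sqrtr0.
Qed.

End RowVectors.

Notation slice f t := (fun y => f (row_cons t y)).

Section GaussianBounds.
Variable R : realType.

Definition gauss1 (e t : R) : R := expR (- (e * t ^+ 2)).

Lemma gauss1_gt0 e t : 0 < gauss1 e t. Proof. exact: expR_gt0. Qed.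

Lemma gauss1_le1 e t : 0 <= e -> gauss1 e t <= 1.
Proof. by move=> e0; rewrite -expR0 ler_expR oppr_le0 mulr_ge0// sqr_ge0. Qed.

Lemma continuous_gauss1 e : continuous (gauss1 e).
Proof.
move=> t; apply: continuous_comp; last exact: continuous_expR.
apply: continuousN; apply: continuousM; first exact: cst_continuous.
exact: exprn_continuous.
Qed.

Definition gaussn (n : nat) (e : R) (x : 'rV[R]_n) : R :=
  expR (- (e * sqnorm x)).

Lemma gaussn_gt0 n e (x : 'rV[R]_n) : 0 < gaussn e x.
Proof. exact: expR_gt0. Qed.

Lemma gaussnD n e1 e2 (x : 'rV[R]_n) :
  gaussn (e1 + e2) x = gaussn e1 x * gaussn e2 x.
Proof. by rewrite /gaussn mulrDl opprD expRD. Qed.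

Lemma gaussn0 n (x : 'rV[R]_n) : gaussn 0 x = 1.
Proof. by rewrite /gaussn mul0r oppr0 expR0. Qed.

Lemma gaussn_row_cons n e t (y : 'rV[R]_n) :
  gaussn e (row_cons t y) = gauss1 e t * gaussn e y.
Proof. by rewrite /gaussn /gauss1 sqnorm_row_cons mulrDr opprD expRD. Qed.

Lemma ler_gaussn n e1 e2 (x : 'rV[R]_n) : e1 <= e2 ->
  gaussn e2 x <= gaussn e1 x.
Proof. by move=> e12; rewrite ler_expR lerN2 ler_wpM2r// sqnorm_ge0. Qed.

Lemma gaussn_le1 n e (x : 'rV[R]_n) : 0 <= e -> gaussn e x <= 1.
Proof. by move=> e0; rewrite -(gaussn0 x) ler_gaussn. Qed.

Lemma continuous_gaussn n e : continuous (@gaussn n e).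
Proof.
move=> x; apply: continuous_comp; last exact: continuous_expR.
apply: continuousN; apply: continuousM; first exact: cst_continuous.
exact: continuous_sqnorm.
Qed.

Lemma normr_gaussn_le1 n e (x : 'rV[R]_n) : 0 <= e -> `|gaussn e x| <= 1.
Proof. by move=> e0; rewrite gtr0_norm ?gaussn_gt0// gaussn_le1. Qed.

Lemma continuous_gaussnB n e a :
  continuous (fun x : 'rV[R]_n => gaussn e (x - a)).
Proof.
move=> x; apply: continuous_comp; last exact: continuous_gaussn.
exact: continuous_translate.
Qed.

(* A negative e allows f to grow. *)
Definition gauss_bounded (n : nat) (C e : R) (f : 'rV[R]_n -> R) :=
  continuous f /\ forall x, `|f x| <= C * gaussn e x.

Definition gauss_dominated (n : nat) (a : R) (f : 'rV[R]_n -> R) :=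
  exists C e, a < e /\ gauss_bounded C e f.

Section Closure.
Variable n : nat.
Implicit Types f g : 'rV[R]_n -> R.

Lemma gauss_bounded_ge0 C e f : gauss_bounded C e f -> 0 <= C.
Proof.
by move=> [_ /(_ 0)]/(le_trans (normr_ge0 _)); rewrite pmulr_lge0// gaussn_gt0.
Qed.

Lemma gauss_boundedW C C' e e' f : C <= C' -> e' <= e ->
  gauss_bounded C e f -> gauss_bounded C' e' f.
Proof.
move=> CC' ee' fC; have C0 := gauss_bounded_ge0 fC; have [cf {}fC] := fC.
split=> // x; apply: (le_trans (fC x)).
by rewrite ler_pM// ?ler_gaussn// ltW// gaussn_gt0.
Qed.

Lemma gauss_bounded_cst c : gauss_bounded `|c| 0 (fun _ : 'rV[R]_n => c).
Proof. by split=> x; [exact: cst_continuous|rewrite gaussn0 mulr1]. Qed.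

Lemma gauss_boundedM C D e e' f g : gauss_bounded C e f ->
  gauss_bounded D e' g ->
  gauss_bounded (C * D) (e + e') (fun x => f x * g x).
Proof.
move=> [cf fC] [cg gD]; split=> x;
  first by apply: continuousM; [exact: cf|exact: cg].
by rewrite normrM gaussnD mulrACA ler_pM.
Qed.

Lemma gauss_bounded_mul_bounded C e f g B : gauss_bounded C e f ->
  continuous g ->
  (forall x, `|g x| <= B) -> gauss_bounded (C * B) e (fun x => f x * g x).
Proof.
move=> fC cg gB; rewrite -[e]addr0; apply: gauss_boundedM => //.
by split=> // x; rewrite gaussn0 mulr1.
Qed.

Lemma gauss_boundedD C D e f g : gauss_bounded C e f -> gauss_bounded D e g ->
  gauss_bounded (C + D) e (fun x => f x + g x).
Proof.
move=> [cf fC] [cg gD]; split=> x;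
  first by apply: continuousD; [exact: cf|exact: cg].
by rewrite (le_trans (ler_normD _ _))// mulrDl lerD.
Qed.

Lemma eq_gauss_dominated a f g : f =1 g -> gauss_dominated a f ->
  gauss_dominated a g.
Proof. by move=> /funext ->. Qed.

Lemma gauss_dominated_cst a c : a < 0 ->
  gauss_dominated a (fun _ : 'rV[R]_n => c).
Proof. by move=> a0; exists `|c|, 0; split=> //; exact: gauss_bounded_cst. Qed.

Lemma gauss_dominated_max2 a f g : gauss_dominated a f -> gauss_dominated a g ->
  exists C e, [/\ a < e, gauss_bounded C e f & gauss_bounded C e g].
Proof.
move=> [C [e [ae fC]]] [D [e' [ae' gD]]].
exists (Num.max C D), (Num.min e e'); split; first by rewrite lt_min ae.
- by apply: gauss_boundedW fC; rewrite ?le_max ?ge_min lexx.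
- by apply: gauss_boundedW gD; rewrite ?le_max ?ge_min lexx orbT.
Qed.

Lemma gauss_dominatedD a f g : gauss_dominated a f -> gauss_dominated a g ->
  gauss_dominated a (fun x => f x + g x).
Proof.
move=> fa /(gauss_dominated_max2 fa)[C [e [ae fC gC]]].
by exists (C + C), e; split=> //; exact: gauss_boundedD.
Qed.

Lemma gauss_dominatedM a D e' f g : gauss_dominated a f ->
  gauss_bounded D e' g ->
  gauss_dominated (a + e') (fun x => f x * g x).
Proof.
move=> [C [e [ae fC]]] gD; exists (C * D), (e + e').
by rewrite ltrD2r; split=> //; exact: gauss_boundedM.
Qed.

Lemma gauss_dominated_mul_bounded a f g B : gauss_dominated a f ->
  continuous g ->
  (forall x, `|g x| <= B) -> gauss_dominated a (fun x => f x * g x).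
Proof.
move=> [C [e [ae fC]]] cg gB; exists (C * B), e; split=> //.
exact: gauss_bounded_mul_bounded.
Qed.

Lemma gauss_dominatedZ a c f : gauss_dominated a f ->
  gauss_dominated a (fun x => c * f x).
Proof.
move=> fa; have cc : continuous (fun _ : 'rV[R]_n => c) by move=> x;
  exact: cst_continuous.
have cf := gauss_dominated_mul_bounded fa cc (fun=> lexx `|c|).
by apply: eq_gauss_dominated cf => x; exact: mulrC.
Qed.

Lemma gauss_dominatedB a f g : gauss_dominated a f -> gauss_dominated a g ->
  gauss_dominated a (fun x => f x - g x).
Proof.
move=> fa /(gauss_dominatedZ (-1))/(gauss_dominatedD fa).
by apply: eq_gauss_dominated => x; rewrite mulN1r.
Qed.

End Closure.

Lemma gauss_bounded_slice n C e (f : 'rV[R]_n.+1 -> R) t :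
  gauss_bounded C e f ->
  gauss_bounded (C * gauss1 e t) e (slice f t).
Proof.
move=> [cf fC]; split=> y; last by rewrite -mulrA -gaussn_row_cons.
exact: (continuous_comp (@continuous_row_cons _ _ t y) (cf _)).
Qed.

Lemma gauss_dominated_slice n a (f : 'rV[R]_n.+1 -> R) t :
  gauss_dominated a f ->
  gauss_dominated a (slice f t).
Proof.
by move=> [C [e [ae /(gauss_bounded_slice t)]]]; exists (C * gauss1 e t), e.
Qed.

End GaussianBounds.

Notation gauss_decay := (gauss_dominated 0).

(* gauss_dens decays like exp(- |x|^2 / 2). *)
Notation gauss_tempered := (gauss_dominated (- 2^-1)).

Section GaussianDecay.
Variable R : realType.

Lemma gauss_decay_affine n (f : 'rV[R]_n -> R) (A : 'M[R]_n) v : A \in unitmx ->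
  gauss_decay f -> gauss_decay (fun x => f (x *m A + v)).
Proof.
move=> uA [C [e [e0 fC]]]; have C0 := gauss_bounded_ge0 fC;
  have [cf {}fC] := fC.
have [K K0 KA] := sqnorm_mulmx_le (invmx A).
have eK : 0 < e / (2 * K) by rewrite divr_gt0// mulr_gt0.
exists (C * expR (e * sqnorm v)), (e / (2 * K)); split=> //; split=> x.
  by apply: continuous_comp; [exact: continuous_affine|exact: cf].
apply: (le_trans (fC _)); rewrite -mulrA ler_wpM2l// /gaussn -expRD ler_expR.
have sqnorm_le : sqnorm x <= K * (2 * (sqnorm (x *m A + v) + sqnorm v)).
  rewrite -{1}(mulmxK uA x) -{1}(addrK v (x *m A)) (le_trans (KA _))//.
  by rewrite ler_pM2l// sqnormB_le.
have : e / (2 * K) * sqnorm x <= e * (sqnorm (x *m A + v) + sqnorm v).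
  rewrite (le_trans (ler_wpM2l (ltW eK) sqnorm_le))//.
  by rewrite [leLHS](_ : _ = e * (sqnorm (x *m A + v) + sqnorm v))//; field;
    lra.
lra.
Qed.

Lemma gauss_decay_mulmx n (f : 'rV[R]_n -> R) (A : 'M[R]_n) : A \in unitmx ->
  gauss_decay f -> gauss_decay (fun x => f (x *m A)).
Proof.
by move=> uA /(gauss_decay_affine 0 uA); apply: eq_gauss_dominated => x;
  rewrite addr0.
Qed.

Lemma gauss_decay_translate n (f : 'rV[R]_n -> R) v :
  gauss_decay f -> gauss_decay (fun x => f (x + v)).
Proof.
move=> /(gauss_decay_affine v (unitmx1 R n)).
by apply: eq_gauss_dominated => x; rewrite mulmx1.
Qed.

End GaussianDecay.

Section GaussianIntegrals.
Variable R : realType.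
Notation mu := (@lebesgue_measure R).

Lemma EFin_Rintegral (F : R -> R) : mu.-integrable setT (EFin \o F) ->
  (\int[mu]_t F t)%R%:E = (\int[mu]_t (F t)%:E)%E.
Proof.
by move=> iF; rewrite /Rintegral fineK//; exact: (integrable_fin_num _ iF).
Qed.

Lemma gauss1_normal_pdf (e t : R) : 0 < e -> let s := Num.sqrt (2 * e)^-1 in
  gauss1 e t = (normal_peak s)^-1 * normal_pdf 0 s t.
Proof.
move=> e0 s; have s0 : s != 0 by rewrite gt_eqF// sqrtr_gt0 invr_gt0 mulr_gt0.
rewrite normal_pdfE// mulrA mulVf ?mul1r;
  last by rewrite gt_eqF// normal_peak_gt0.
rewrite /gauss1 /normal_fun subr0 sqr_sqrtr ?invr_ge0 ?mulr_ge0 ?ltW//.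
by congr expR; rewrite mulr2n; field; lra.
Qed.

Lemma integrable_gauss1 (e : R) : 0 < e ->
  mu.-integrable setT (EFin \o gauss1 e).
Proof.
move=> e0; pose s := Num.sqrt (2 * e)^-1.
have -> : EFin \o gauss1 e =
    (fun t => ((normal_peak s)^-1)%:E * (normal_pdf 0 s t)%:E)%E.
  by apply/funext => t /=; rewrite gauss1_normal_pdf// EFinM.
by apply: integrableZl => //; exact: integrable_normal_pdf.
Qed.

Definition gauss_mass (e : R) : R := \int[mu]_t gauss1 e t.

Lemma gauss_mass_ge0 (e : R) : 0 <= gauss_mass e.
Proof. by apply: Rintegral_ge0 => t _; exact/ltW/gauss1_gt0. Qed.

Lemma integral_gauss1Z (e k : R) : 0 < e ->
  (\int[mu]_t (k * gauss1 e t)%:E = (k * gauss_mass e)%:E)%E.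
Proof.
move=> e0; under eq_integral do rewrite EFinM.
rewrite integralZl//; last exact: integrable_gauss1.
by rewrite EFinM EFin_Rintegral//; exact: integrable_gauss1.
Qed.

Lemma integrable_le_gauss1 (F : R -> R) C e : 0 < e -> measurable_fun setT F ->
  (forall t, `|F t| <= C * gauss1 e t) -> mu.-integrable setT (EFin \o F).
Proof.
move=> e0 mF FC; apply: (@le_integrable _ _ _ mu _ _ _
    (fun t => C%:E * (gauss1 e t)%:E)%E) => //.
- exact/measurable_EFinP.
- by move=> t _ /=; rewrite lee_fin (le_trans (FC t))// ler_norm.
- by apply: integrableZl => //; exact: integrable_gauss1.
Qed.

Lemma normr_Rintegral_le_gauss1 (F : R -> R) C e : 0 < e ->
  measurable_fun setT F ->
  (forall t, `|F t| <= C * gauss1 e t) -> `|\int[mu]_t F t| <= C * gauss_mass e.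
Proof.
move=> e0 mF FC; have iF := integrable_le_gauss1 e0 mF FC.
rewrite -lee_fin -integral_gauss1Z// EFin_normr_Rintegral//.
apply: le_trans (le_abse_integral mu measurableT _) _;
  first exact/measurable_EFinP.
apply: ge0_le_integral => //.
- by apply: measurableT_comp => //; exact/measurable_EFinP.
- apply/measurable_EFinP; apply: measurable_funM => //.
  by apply: continuous_measurable_fun; exact: continuous_gauss1.
- by move=> t _; rewrite lee_fin; exact: FC.
Qed.

Lemma cvg_Rintegral_gauss1 (F_ : nat -> R -> R) (F : R -> R) C e : 0 < e ->
  (forall k, measurable_fun setT (F_ k)) -> measurable_fun setT F ->
  (forall k t, `|F_ k t| <= C * gauss1 e t) ->
  (forall t, F_ k t @[k --> \oo] --> F t) ->
  \int[mu]_t F_ k t @[k --> \oo] --> \int[mu]_t F t.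
Proof.
move=> e0 mF_ mF FC FF.
have [iF _ cF] : [/\ mu.-integrable setT (EFin \o F),
    [sequence \int[mu]_t `|(F_ n t)%:E - (F t)%:E|]_n%E @ \oo --> 0%E &
    [sequence \int[mu]_t (F_ n t)%:E]_n%E @ \oo --> (\int[mu]_t (F t)%:E)%E].
  apply: (@dominated_convergence _ _ _ mu setT measurableT
      (fun k t => (F_ k t)%:E) _ (fun t => C%:E * (gauss1 e t)%:E)%E).
  - by move=> k; apply/measurable_EFinP; exact: mF_.
  - exact/measurable_EFinP.
  - by apply: aeW => t _; apply: cvg_EFin; [exact: nearW|exact: FF].
  - by apply: integrableZl => //; exact: integrable_gauss1.
  - by apply: aeW => t k _; rewrite -EFinM lee_fin.
by rewrite /Rintegral; apply: fine_cvg; rewrite fineK//;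
  exact: integrable_fin_num iF.
Qed.

End GaussianIntegrals.

Section AffineChangeOfVariable.
Variable R : realType.
Notation mu := (@lebesgue_measure R).

Let ge0_integral_affine_gt0 (G : R -> R) (a b : R) : 0 < a -> continuous G ->
  (forall t, 0 <= G t) ->
  (\int[mu]_t (G t)%:E = \int[mu]_t (a * G ((t + b) * a))%:E)%E.
Proof.
move=> a0 cG G0; pose F (t : R^o) : R := (t + b) * a.
have F'E : F^`()%classic = cst a.
  apply/funext => x; rewrite /F derive1E deriveM// deriveD// derive_cst scaler0.
  by rewrite add0r derive_id derive_cst addr0; exact: mulr1.
rewrite (@increasing_ge0_integration_by_substitutionT _ F G) ?F'E//.
- by apply: eq_integral => t _; rewrite [RHS]EFinM muleC.
- by move=> x y xy; rewrite /F ltr_pM2r// ltrD2r.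
- by move=> x; exact: cvg_cst.
- exact: is_cvg_cst.
- exact: is_cvg_cst.
- by apply/gt0_cvgMlNy => //; exact: cvg_addrr_Ny.
- by apply/gt0_cvgMly => //; exact: cvg_addrr.
Qed.

Lemma ge0_integral_oppr (G : R -> R) : continuous G -> (forall t, 0 <= G t) ->
  (\int[mu]_t (G t)%:E = \int[mu]_t (G (- t))%:E)%E.
Proof.
have halves (H : R -> R) : continuous H -> (forall t, 0 <= H t) ->
    (\int[mu]_t (H t)%:E = \int[mu]_(t in `[0%R, +oo[) (H (- t))%:E +
                           \int[mu]_(t in `[0%R, +oo[) (H t)%:E)%E.
  move=> cH H0.
  have mH D : measurable_fun D (EFin \o H).
    by apply/measurable_EFinP/measurable_funTS;
      exact: continuous_measurable_fun.
  rewrite -(setvU `]-oo, (0:R)]%classic) setUC ge0_integral_setU//=; first last.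
  - exact/disj_setPCl.
  - by move=> x _; rewrite lee_fin.
  - exact: mH.
  - exact: measurableC.
  rewrite -[in X in (X + _)%E](oppr0 R) ge0_integration_by_substitutionNy//;
    last first.
    exact: continuous_subspaceT.
  by rewrite setCitvl integral_itv_obnd_cbnd//; exact: mH.
move=> cG G0; rewrite halves// halves//.
  by rewrite addeC; congr (_ + _)%E; apply: eq_integral => t _; rewrite ?opprK.
by move=> t; apply: continuous_comp; [exact: opp_continuous|exact: cG].
Qed.

Let ge0_integral_affine (G : R -> R) (a b : R) : a != 0 -> continuous G ->
  (forall t, 0 <= G t) ->
  (\int[mu]_t (G t)%:E = \int[mu]_t (`|a| * G ((t + b) * a))%:E)%E.
Proof.
move=> a0 cG G0; have [a_lt0|a_gt0|aE] := ltgtP a 0;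
  last by rewrite aE eqxx in a0.
  rewrite ge0_integral_oppr// (@ge0_integral_affine_gt0 _ (- a) b) ?oppr_gt0//.
    by apply: eq_integral => t _; rewrite mulrN opprK ltr0_norm.
  by move=> t; apply: continuous_comp; [exact: opp_continuous|exact: cG].
by rewrite gtr0_norm//; exact: ge0_integral_affine_gt0.
Qed.

Lemma Rintegral_affine (F : R -> R) (a b : R) : a != 0 -> continuous F ->
  \int[mu]_t F t = \int[mu]_t (`|a| * F ((t + b) * a)).
Proof.
have funeposEF (G : R -> R) :
    ((fun t => (G t)%:E)^\+)%E = (fun t => (Num.max (G t) 0)%:E).
  by apply/funext => t; rewrite funeposE EFin_max.
have pos (G : R -> R) : a != 0 -> continuous G ->
    (\int[mu]_t ((fun t => (G t)%:E)^\+ t) =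
     \int[mu]_t ((fun t => (`|a| * G ((t + b) * a))%:E)^\+ t))%E.
  move=> a0 cG; rewrite !funeposEF (ge0_integral_affine b a0); last 2 first.
  - by move=> t; apply: continuous_max; [exact: cG|exact: cvg_cst].
  - by move=> t; rewrite le_max lexx orbT.
  by apply: eq_integral => t _; rewrite maxr_pMr ?normr_ge0// mulr0.
move=> a0 cF; rewrite /Rintegral integralE [in RHS]integralE -!funeposN.
congr (fine (_ - _)%E); first exact: pos.
under [RHS]eq_integral do rewrite funeposN.
rewrite (pos (fun t => - F t))//;
  last by move=> t; apply: continuousN; exact: cF.
by congr integral; rewrite -funeposN; congr funepos; apply/funext => t;
  rewrite mulrN EFinN.
Qed.

End AffineChangeOfVariable.

Section Fubini.
Variable R : realType.
Notation mu := (@lebesgue_measure R).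

Lemma dist_eq_floor (K s t : R) : 0 < K ->
  Num.floor (s * K) = Num.floor (t * K) -> `|s - t| < K^-1.
Proof.
move=> K0 st; rewrite -(ltr_pM2r K0) mulVf ?gt_eqF//.
rewrite -{1}(gtr0_norm K0) -normrM mulrBl ltr_norml.
have /andP[s1 s2] := floor_itv (s * K); have /andP[t1 t2] := floor_itv (t * K).
rewrite st in s1 s2; rewrite intrD in s2 t2; lra.
Qed.

(* A function continuous in its first variable is the limit of the functions
   obtained by rounding that variable down to multiples of 1/(k+1). *)
Lemma measurable_caratheodory d (T : measurableType d) (F : R -> T -> R) :
  (forall s, measurable_fun setT (F s)) -> (forall t, continuous (F ^~ t)) ->
  measurable_fun setT (fun z : R * T => F z.1 z.2).
Proof.
move=> mF cF; pose K k : R := k.+1%:R; have K0 k : 0 < K k by exact: ltr0Sn.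
pose grid k s : R := (Num.floor (s * K k))%:~R / K k.
have cvg_grid s : grid k s @[k --> \oo] --> s.
  apply/cvgrPdist_lt => e e0; near=> k.
  apply: (@lt_trans _ _ (K k)^-1);
    last by near: k; exact: near_infty_natSinv_lt (PosNum e0).
  by apply: dist_eq_floor => //; rewrite divfK ?gt_eqF// intrKfloor.
apply: (@measurable_fun_cvg _ _ _ _ (fun k z => F (grid k z.1) z.2));
  last first.
  move=> [s t] _ /=;
    apply: (@continuous_cvg _ _ _ _ _ (grid ^~ s) (F ^~ t)) => //.
  exact: cF.
move=> k _ B mB; rewrite setTI.
have -> : (fun z : R * T => F (grid k z.1) z.2) @^-1` B = \bigcup_(z : int)
    (`[z%:~R / K k, (z + 1)%:~R / K k[ `*` (F (z%:~R / K k) @^-1` B)).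
  apply/seteqP; split=> [[s t] /= Bst|[s t] [z _ []]] /=.
    exists (Num.floor (s * K k)) => //; split=> //=.
    by rewrite in_itv/= ler_pdivrMr// ltr_pdivlMr//; exact: floor_itv.
  by rewrite in_itv/= ler_pdivrMr// ltr_pdivlMr// /grid => /floor_def <-.
apply: countable_bigcupT_measurable => // z; apply: measurableX => //.
by rewrite -[X in measurable X]setTI; exact: mF.
Unshelve. all: by end_near. Qed.

Lemma Rintegral_Fubini (F : R -> R -> R) C e : 0 < e ->
  (forall s, continuous (F s)) -> (forall t, continuous (F ^~ t)) ->
  (forall s t, `|F s t| <= C * (gauss1 e s * gauss1 e t)) ->
  \int[mu]_s \int[mu]_t F s t = \int[mu]_t \int[mu]_s F s t.
Proof.
move=> e0 cF cF' FC.
have mF : measurable_fun setT (fun z : R * R => F z.1 z.2).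
  by apply: measurable_caratheodory => // s; exact: continuous_measurable_fun.
pose G (z : R * R) : R := `|C| * (gauss1 e z.1 * gauss1 e z.2).
have mg : measurable_fun setT (gauss1 e).
  by apply: continuous_measurable_fun; exact: continuous_gauss1.
have mG : measurable_fun setT G.
  apply: measurable_funM => //; apply: measurable_funM.
    exact: measurableT_comp measurable_fst.
  exact: measurableT_comp measurable_snd.
have iG : (mu \x mu)%E.-integrable setT (EFin \o G).
  apply/integrable12ltyP; first exact/measurable_EFinP.
  under eq_integral => s _.
    under eq_integral => t _.
      rewrite /= /G /= ger0_norm; last by rewrite !mulr_ge0// ltW// gauss1_gt0.
      rewrite mulrA; over.
    rewrite integral_gauss1Z// mulrAC; over.
  by rewrite integral_gauss1Z// ltry.
have iF : (mu \x mu)%E.-integrable setT (EFin \o (fun z : R * R => F z.1 z.2)).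
  apply: le_integrable iG => //; first exact/measurable_EFinP.
  move=> [s t] _ /=; rewrite lee_fin (le_trans (FC s t))//.
  by rewrite (le_trans (ler_norm _))// !normrM normr_id.
have inner_s s : (\int[mu]_t F s t)%R%:E = (\int[mu]_t (F s t)%:E)%E.
  apply/EFin_Rintegral/(integrable_le_gauss1 (C := C * gauss1 e s) e0).
    exact: continuous_measurable_fun.
  by move=> t; rewrite -mulrA.
have inner_t t : (\int[mu]_s F s t)%R%:E = (\int[mu]_s (F s t)%:E)%E.
  apply/EFin_Rintegral/(integrable_le_gauss1 (C := C * gauss1 e t) e0).
    by apply: continuous_measurable_fun; exact: cF'.
  by move=> s; rewrite -mulrA [X in _ * X]mulrC.
rewrite /Rintegral -/(Rintegral _ _ _); congr fine.
under eq_integral do rewrite inner_s.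
under [RHS]eq_integral do rewrite inner_t.
exact: (Fubini iF).
Qed.

End Fubini.

Section IteratedIntegral.
Variable R : realType.
Notation mu := (@lebesgue_measure R).

(* Real-valued counterpart of wint, to be used on continuous functions with
   Gaussian decay only: integrating out one variable preserves this class, so the
   theory goes by induction on n and involves only integrals over R. *)
Fixpoint iterint (n : nat) : ('rV[R]_n -> R) -> R :=
  match n with
  | 0 => fun f => f 0
  | n'.+1 => fun f => \int[mu]_t iterint (fun y : 'rV[R]_n' => f (row_cons t y))
  end.

Lemma iterint0 (f : 'rV[R]_0 -> R) : iterint f = f 0. Proof. by []. Qed.

Lemma iterintS n (f : 'rV[R]_n.+1 -> R) :
  iterint f = \int[mu]_t iterint (slice f t).
Proof. by []. Qed.

Lemma eq_iterint n (f g : 'rV[R]_n -> R) : f =1 g -> iterint f = iterint g.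
Proof. by move=> /funext ->. Qed.

Definition iterint_bound (n : nat) := forall (f : 'rV[R]_n -> R) C e,
  0 < e -> gauss_bounded C e f -> `|iterint f| <= C * gauss_mass e ^+ n.

Definition iterint_dominated_cvg (n : nat) :=
  forall (f_ : nat -> 'rV[R]_n -> R) f C e, 0 < e ->
    (forall k, gauss_bounded C e (f_ k)) -> gauss_bounded C e f ->
    (forall x, f_ k x @[k --> \oo] --> f x) ->
  iterint (f_ k) @[k --> \oo] --> iterint f.

Lemma dominated_cvg_slice_continuous n (f : 'rV[R]_n.+1 -> R) C e :
  iterint_dominated_cvg n -> 0 < e -> gauss_bounded C e f ->
  continuous (fun t => iterint (slice f t)).
Proof.
move=> dct e0 fC t; have [cf _] := fC; apply/(@cvg_nbhsP _ R^o) => u ut.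
have slice_bounded s : gauss_bounded C e (slice f s).
  apply: gauss_boundedW (gauss_bounded_slice s fC) => //.
  by rewrite ler_piMr ?(gauss_bounded_ge0 fC)// gauss1_le1// ltW.
apply: (dct _ _ C e) => // x.
apply: (@continuous_cvg _ _ _ _ _ (fun k => row_cons (u k) x) f) => //;
  first exact: cf.
by apply: cvg_row_cons => //; exact: cvg_cst.
Qed.

Lemma iterint_bound_dominated_cvg n :
  iterint_bound n /\ iterint_dominated_cvg n.
Proof.
elim: n => [|n [bound dct]].
  split=> [f C e e0 [_ fC]|f_ f C e e0 _ _ ff]; last exact: ff.
  by rewrite expr0 (le_trans (fC 0))// /gaussn sqnorm_rV0 mulr0 oppr0 expR0.
have mslice (f : 'rV[R]_n.+1 -> R) C e : 0 < e -> gauss_bounded C e f ->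
    measurable_fun setT (fun t => iterint (slice f t)).
  move=> e0 fC; apply: continuous_measurable_fun.
  exact: dominated_cvg_slice_continuous fC.
have slice_le (f : 'rV[R]_n.+1 -> R) C e t : 0 < e -> gauss_bounded C e f ->
    `|iterint (slice f t)|
      <= C * gauss_mass e ^+ n * gauss1 e t.
  by move=> e0 /(gauss_bounded_slice t) fC; rewrite mulrAC; exact: bound.
split=> [f C e e0 fC|f_ f C e e0 f_C fC ff].
  rewrite iterintS exprSr mulrA.
  by apply: normr_Rintegral_le_gauss1 (mslice _ _ _ e0 fC) _ => // t;
    exact: slice_le.
apply: (cvg_Rintegral_gauss1 (C := C * gauss_mass e ^+ n) e0).
- by move=> k; exact: mslice (f_C k).
- exact: mslice fC.
- by move=> k t; exact: slice_le.
- move=> t; apply: (dct _ _ (C * gauss1 e t) e) => // [k|].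
  + exact: gauss_bounded_slice.
  + exact: gauss_bounded_slice.
Qed.

Lemma cvg_iterint n : iterint_dominated_cvg n.
Proof. by have [] := iterint_bound_dominated_cvg n. Qed.

Section Slices.
Variables (n : nat) (f : 'rV[R]_n.+1 -> R) (C e : R).
Hypotheses (e_gt0 : 0 < e) (fC : gauss_bounded C e f).

Lemma continuous_iterint_slice :
  continuous (fun t => iterint (slice f t)).
Proof. exact: (dominated_cvg_slice_continuous (@cvg_iterint n) e_gt0 fC). Qed.

Lemma normr_iterint_slice_le t :
  `|iterint (slice f t)|
    <= C * gauss_mass e ^+ n * gauss1 e t.
Proof.
have [bound _] := iterint_bound_dominated_cvg n.
by rewrite mulrAC; exact: bound (gauss_bounded_slice t fC).
Qed.

Lemma integrable_iterint_slice :
  mu.-integrable setT (EFin \o (fun t => iterint (slice f t))).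
Proof.
apply: integrable_le_gauss1 e_gt0 _ normr_iterint_slice_le.
by apply: continuous_measurable_fun; exact: continuous_iterint_slice.
Qed.

End Slices.

Lemma iterintZ n (f : 'rV[R]_n -> R) c : gauss_decay f ->
  iterint (fun x => c * f x) = c * iterint f.
Proof.
elim: n f => [//|n IH] f f_decay; rewrite !iterintS.
have sliceZ t := IH _ (gauss_dominated_slice t f_decay).
under eq_fun do rewrite sliceZ.
by have [C [e [e0 fC]]] := f_decay; rewrite RintegralZl//;
  exact: integrable_iterint_slice fC.
Qed.

Lemma iterintD n (f g : 'rV[R]_n -> R) : gauss_decay f -> gauss_decay g ->
  iterint (fun x => f x + g x) = iterint f + iterint g.
Proof.
elim: n f g => [//|n IH] f g f_decay g_decay; rewrite !iterintS.
have sliceD t :=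
  IH _ _ (gauss_dominated_slice t f_decay) (gauss_dominated_slice t g_decay).
under eq_fun do rewrite sliceD.
have [C [e [e0 fC gC]]] := gauss_dominated_max2 f_decay g_decay.
by rewrite RintegralD//;
  [exact: integrable_iterint_slice fC|exact: integrable_iterint_slice gC].
Qed.

Lemma iterint_translate n (f : 'rV[R]_n -> R) v : gauss_decay f ->
  iterint (fun x => f (x + v)) = iterint f.
Proof.
elim: n f v => [f v _|n IH f v f_decay].
  by rewrite !iterint0; congr f; apply/rowP => -[].
have [C [e [e0 fC]]] := f_decay.
rewrite !iterintS [RHS](Rintegral_affine (v 0 ord0) (oner_neq0 _)); last first.
  exact: continuous_iterint_slice fC.
congr Rintegral; apply/funext => t; rewrite normr1 mul1r mulr1.
rewrite -(IH _ (col' ord0 v) (gauss_dominated_slice _ f_decay)).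
by apply: eq_iterint => y; rewrite -row_consD row_cons_eta.
Qed.

Lemma gauss_bounded_insert1 n C e s (f : 'rV[R]_n.+2 -> R) :
  gauss_bounded C e f ->
  gauss_bounded (C * gauss1 e s) e
    (fun x : 'rV[R]_n.+1 => f (row_cons (x 0 ord0) (row_cons s (col' ord0 x)))).
Proof.
move=> [cf fC]; split=> x.
  apply: (@continuous_comp _ _ _
    (fun x : 'rV[R]_n.+1 => row_cons (x 0 ord0) (row_cons s (col' ord0 x))) f);
    last exact: cf.
  apply: (@cvg_row_cons _ _ _ (nbhs x)); first exact: coord_continuous.
  apply: (@cvg_row_cons _ _ _ (nbhs x)); first exact: cvg_cst.
  apply: cvg_mx => i j; under eq_fun do rewrite mxE; rewrite mxE.
  exact: coord_continuous.
rewrite (le_trans (fC _))// -{3}(row_cons_eta x) !gaussn_row_cons -!mulrA.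
by rewrite (mulrCA (gauss1 e s)).
Qed.

Lemma iterint_exchange n (f : 'rV[R]_n.+1 -> R) : gauss_decay f ->
  iterint f = iterint (fun y => \int[mu]_t f (row_cons t y)).
Proof.
elim: n f => [//|n IH] f [C [e [e0 fC]]].
pose F t s := iterint (fun z : 'rV[R]_n => f (row_cons t (row_cons s z))).
pose fs s (x : 'rV[R]_n.+1) :=
  f (row_cons (x 0 ord0) (row_cons s (col' ord0 x))).
have fsC s : gauss_bounded (C * gauss1 e s) e (fs s)
  by exact: gauss_bounded_insert1.
have fsE s t z : fs s (row_cons t z) = f (row_cons t (row_cons s z)).
  by rewrite /fs row_cons0 row_consK.
have FE s : F ^~ s = (fun t => iterint (slice (fs s) t)).
  by apply/funext => t; apply: eq_iterint => z; rewrite fsE.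
have -> : iterint f = \int[mu]_t \int[mu]_s F t s by [].
rewrite (Rintegral_Fubini (C := C * gauss_mass e ^+ n) e0).
- rewrite iterintS; congr Rintegral; apply/funext => s.
  rewrite FE -iterintS IH; last by exists (C * gauss1 e s), e.
  by apply: eq_iterint => z; congr Rintegral; apply/funext => t; rewrite fsE.
- by move=> t; exact: (continuous_iterint_slice e0 (gauss_bounded_slice t fC)).
- by move=> s; rewrite FE; exact: (continuous_iterint_slice e0 (fsC s)).
- move=> t s.
  rewrite (le_trans (normr_iterint_slice_le e0 (gauss_bounded_slice t fC) s))//.
  by rewrite mulrA (mulrAC C).
Qed.

End IteratedIntegral.

Section LinearChangeOfVariables.
Variable R : realType.

Definition iterint_det_scaling (n : nat) (A : 'M[R]_n) :=
  forall f : 'rV[R]_n -> R, gauss_decay f ->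
  iterint (fun x => `|\det A| * f (x *m A)) = iterint f.

Lemma iterint_det_scalingM n (A B : 'M[R]_n) : A \in unitmx -> B \in unitmx ->
  iterint_det_scaling A -> iterint_det_scaling B ->
    iterint_det_scaling (A *m B).
Proof.
move=> uA uB hA hB f f_decay.
have fB_decay : gauss_decay (fun x => `|\det B| * f (x *m B)).
  exact: gauss_dominatedZ (gauss_decay_mulmx uB f_decay).
rewrite -(hB f f_decay) -(hA _ fB_decay).
by apply: eq_iterint => x; rewrite det_mulmx normrM mulmxA mulrA.
Qed.

Lemma row_cons_mul_block n t (y : 'rV[R]_n) a b c (D : 'M[R]_n) :
  row_cons t y *m (block_mx a%:M b c D : 'M[R]_(1 + n)) =
  row_cons (t * a + (y *m c) 0 0) (t *: b + y *m D).
Proof.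
apply: etrans (mul_row_block _ y _ b c D) _; congr row_mx.
  by apply/rowP => j; rewrite ord1 !mxE big_ord1 !mxE mulr1n.
by congr (_ + _); apply/rowP => j; rewrite !mxE big_ord1 !mxE.
Qed.

Lemma iterint_det_scaling_ublock n a (b : 'rV[R]_n) (D : 'M[R]_n) : a != 0 ->
  D \in unitmx -> iterint_det_scaling D ->
  iterint_det_scaling (block_mx a%:M b 0 D : 'M[R]_(1 + n)).
Proof.
move=> a0 uD hD f f_decay; have [C [e [e0 fC]]] := f_decay.
rewrite [in RHS]iterintS (Rintegral_affine 0 a0);
  last exact: continuous_iterint_slice fC.
rewrite iterintS; congr Rintegral; apply/funext => t; rewrite addr0.
have slice_decay := gauss_dominated_slice (t * a) f_decay.
have shifted_decay := gauss_decay_translate (t *: b) slice_decay.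
rewrite -(iterint_translate (t *: b) slice_decay) -iterintZ//.
rewrite -(hD _ (gauss_dominatedZ `|a| shifted_decay)).
apply: eq_iterint => y; rewrite det_ublock det_scalar1 normrM mulrCA mulrA.
by rewrite row_cons_mul_block mulmx0 mxE addr0 addrC.
Qed.

Lemma iterint_det_scaling_lshear n (c : 'cV[R]_n) :
  iterint_det_scaling (block_mx 1%:M 0 c 1%:M : 'M[R]_(1 + n)).
Proof.
set L := block_mx _ _ _ _ => f f_decay; have [C [e [e0 [cf _]]]] := f_decay.
have detL : \det L = 1 by rewrite det_lblock !det1 mulr1.
have fL_decay : gauss_decay (fun x => `|\det L| * f (x *m L)).
  apply: gauss_dominatedZ; apply: gauss_decay_mulmx => //.
  by rewrite unitmxE detL unitr1.
rewrite [LHS]iterint_exchange// [RHS]iterint_exchange//; apply: eq_iterint => y.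
have cfy : continuous (fun t : R => f (row_cons t y)).
  by move=> t; exact: (continuous_comp (@continuous_row_consl _ _ y t) (cf _)).
rewrite [RHS](Rintegral_affine ((y *m c) 0 0) (oner_neq0 _) cfy).
congr Rintegral; apply/funext => t.
by rewrite detL row_cons_mul_block scaler0 add0r mulmx1 !mulr1.
Qed.

Lemma ulsubmx11 n (A : 'M[R]_(1 + n)) : ulsubmx A = (A 0 0)%:M.
Proof.
rewrite [LHS]mx11_scalar; congr (_%:M); rewrite !mxE.
by congr (A _ _); exact/val_inj.
Qed.

Lemma ushear_pivot n (A : 'M[R]_(1 + n)) : A \in unitmx ->
  exists v : 'rV[R]_n, (block_mx 1%:M v 0 1%:M *m A) 0 0 != 0.
Proof.
move=> uA; have shearE (v : 'rV[R]_n) :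
    (block_mx 1%:M v 0 1%:M *m A) 0 0 = A 0 0 + (v *m dlsubmx A) 0 0.
  rewrite -{1}(submxK A) mulmx_block !mul1mx mul0mx add0r.
  have entry00 (B : 'M[R]_(1 + n)) :
    B 0 0 = ulsubmx B 0 0 by rewrite ulsubmx11 mxE.
  by rewrite [LHS]entry00 block_mxKul mxE entry00.
have [A00|A00] := eqVneq (A 0 0) 0; last first.
  by exists 0; rewrite shearE mul0mx mxE addr0.
have [col0|/matrix0Pn[i [j]]] := eqVneq (dlsubmx A) 0; last first.
  rewrite ord1 => dl0; exists (delta_mx 0 i).
  by rewrite shearE A00 add0r -rowE mxE.
move: uA; rewrite -(submxK A) col0 unitmxE det_ublock ulsubmx11 A00.
by rewrite det_scalar1 mul0r unitr0.
Qed.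

Definition schur_complement n (A : 'M[R]_(1 + n)) : 'M[R]_n :=
  drsubmx A - (A 0 0)^-1 *: dlsubmx A *m ursubmx A.

Lemma schur_factorization n (A : 'M[R]_(1 + n)) : A 0 0 != 0 ->
  A = block_mx 1%:M 0 ((A 0 0)^-1 *: dlsubmx A) 1%:M *m
      block_mx (A 0 0)%:M (ursubmx A) 0 (schur_complement A).
Proof.
move=> A00; rewrite mulmx_block !mul1mx !mul0mx !addr0 mul_mx_scalar scalerA.
by rewrite mulfV// scale1r addrC subrK -ulsubmx11 submxK.
Qed.

Lemma iterint_det_scaling_pivot n (A : 'M[R]_(1 + n)) : A \in unitmx ->
  A 0 0 != 0 ->
  (forall D : 'M[R]_n, D \in unitmx -> iterint_det_scaling D) ->
  iterint_det_scaling A.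
Proof.
move=> uA A00 scaling_n; have AE := schur_factorization A00.
move: uA; rewrite AE unitmx_mul => /andP[uL uU].
apply: iterint_det_scalingM => //; first exact: iterint_det_scaling_lshear.
apply: iterint_det_scaling_ublock => //; last apply: scaling_n.
  all: by move: uU; rewrite !unitmxE det_ublock unitrM => /andP[].
Qed.

Lemma iterint_mulmx n (A : 'M[R]_n) : A \in unitmx -> iterint_det_scaling A.
Proof.
elim: n A => [|n IH] A uA.
  move=> f _; rewrite !iterint0 det_mx00 normr1 mul1r.
  by congr f; apply/rowP => -[].
pose ushear (v : 'rV[R]_n) : 'M[R]_(1 + n) := block_mx 1%:M v 0 1%:M.
have ushearK v : ushear (- v) *m ushear v = 1%:M.
  rewrite /ushear mulmx_block !mul1mx !mulmx1 !mul0mx !mulmx0 !addr0 !add0r.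
  by rewrite subrr -scalar_mx_block.
have scaling_ushear v : iterint_det_scaling (ushear v).
  apply: iterint_det_scaling_ublock; rewrite ?oner_neq0 ?unitmx1// => f _.
  by apply: eq_iterint => y; rewrite det1 normr1 mul1r mulmx1.
have [v pivot] := @ushear_pivot n A uA.
have [uSN uS] := mulmx1_unit (ushearK v).
have uSA : ushear v *m A \in unitmx by rewrite unitmx_mul uS.
rewrite -[A]mul1mx -(ushearK v) -mulmxA; apply: iterint_det_scalingM => //.
exact: iterint_det_scaling_pivot.
Qed.

End LinearChangeOfVariables.

Section Differentiation.
Variable R : realType.
Notation mu := (@lebesgue_measure R).

Lemma is_derive_iterint n (f Df : R -> 'rV[R]_n -> R) (u v C e : R) : 0 < e ->
  (forall t, t \in `]u, v[ -> gauss_bounded C e (f t)) ->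
  (forall t, t \in `]u, v[ -> gauss_bounded C e (Df t)) ->
  (forall t y, t \in `]u, v[ -> is_derive t 1 (f ^~ y) (Df t y)) ->
  forall a, a \in `]u, v[ ->
    is_derive a 1 (fun t => iterint (f t)) (iterint (Df a)).
Proof.
move=> e0; elim: n f Df C => [f Df C _ _ df a auv|n IH f Df C fC DfC df a auv].
  exact: df.
pose F t s := iterint (slice (f t) s).
have dF t s : t \in `]u, v[ ->
    is_derive t 1 (F ^~ s) (iterint (slice (Df t) s)).
  apply: (IH _ (fun t y => Df t (row_cons s y)) (C * gauss1 e s)) => {}t.
  - by move=> /fC; exact: gauss_bounded_slice.
  - by move=> /DfC; exact: gauss_bounded_slice.
have dFE t s : t \in `]u, v[ ->
    partial1of2 F t s = iterint (slice (Df t) s).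
  by move=> tuv; have ? := dF t s tuv; rewrite partial1of2E derive_val.
pose B s := C * gauss_mass e ^+ n * gauss1 e s.
have C0 := gauss_bounded_ge0 (fC a auv).
have B0 s : 0 <= B s.
  by rewrite !mulr_ge0 ?exprn_ge0 ?gauss_mass_ge0// ltW ?gauss1_gt0.
have iB : mu.-integrable setT (EFin \o B).
  apply: (integrable_le_gauss1 (C := C * gauss_mass e ^+ n) e0) => [|s].
    apply: measurable_funM => //; apply: continuous_measurable_fun.
    exact: continuous_gauss1.
  by rewrite ger0_norm.
have iF t : t \in `]u, v[ -> mu.-integrable setT (EFin \o F t).
  by move=> /fC; exact: integrable_iterint_slice.
have derF t s : t \in `]u, v[ -> setT s -> derivable (F ^~ s) t 1.
  by move=> /(dF _ s).
have DF_le t s : t \in `]u, v[ -> setT s -> `|partial1of2 F t s| <= B s.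
  by move=> tuv _; rewrite dFE//; exact: normr_iterint_slice_le (DfC t tuv) s.
apply: DeriveDef.
  exact: (derivable_under_integral measurableT auv iF derF B0 iB DF_le).
rewrite -derive1E.
rewrite (differentiation_under_integral measurableT auv iF derF B0 iB DF_le).
by apply: eq_Rintegral => s _; exact: dFE.
Qed.

End Differentiation.

Section GaussianMean.
Variable R : realType.
Notation mu := (@lebesgue_measure R).

Definition gauss_peak (n : nat) : R := (Num.sqrt (pi *+ 2) ^+ n)^-1.

Lemma sqrt_2pi_gt0 : 0 < Num.sqrt (pi *+ 2) :> R.
Proof. by rewrite sqrtr_gt0 mulrn_wgt0// pi_gt0. Qed.

Lemma gauss_peak_gt0 n : 0 < gauss_peak n.
Proof. by rewrite invr_gt0 exprn_gt0// sqrt_2pi_gt0. Qed.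

Lemma gauss_densE n (x : 'rV[R]_n) :
  gauss_dens x = gauss_peak n * gaussn 2^-1 x.
Proof. by rewrite /gaussn [2^-1 * _]mulrC. Qed.

Lemma gauss_dens_gt0 n (x : 'rV[R]_n) : 0 < gauss_dens x.
Proof. by rewrite gauss_densE mulr_gt0 ?gauss_peak_gt0 ?gaussn_gt0. Qed.

Lemma gauss_dens_rV0 (x : 'rV[R]_0) : gauss_dens x = 1.
Proof.
by rewrite /gauss_dens sqnorm_rV0 expr0 invr1 mul0r oppr0 expR0 mulr1.
Qed.

Lemma normal_pdf01E (t : R) :
  normal_pdf 0 1 t = (Num.sqrt (pi *+ 2))^-1 * gauss1 2^-1 t.
Proof.
rewrite normal_pdfE ?oner_eq0// /normal_peak /normal_fun expr1n mul1r subr0.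
by rewrite mulNr [_ ^+ 2 / _]mulrC.
Qed.

Lemma normal_pdf01_gt0 (t : R) : 0 < normal_pdf 0 1 t.
Proof.
by rewrite normal_pdf01E mulr_gt0 ?gauss1_gt0// invr_gt0 sqrt_2pi_gt0.
Qed.

Lemma continuous_normal_pdf01 : continuous (@normal_pdf R 0 1).
Proof. by apply: continuous_normal_pdf; rewrite oner_eq0. Qed.

Lemma gauss_dens_row_cons n t (y : 'rV[R]_n) :
  gauss_dens (row_cons t y) = normal_pdf 0 1 t * gauss_dens y.
Proof.
by rewrite !gauss_densE gaussn_row_cons normal_pdf01E /gauss_peak exprS invfM
  mulrACA.
Qed.

Lemma gauss_bounded_dens n :
  gauss_bounded (gauss_peak n) 2^-1 (@gauss_dens R n).
Proof.
split=> [|x]; last by rewrite gtr0_norm ?gauss_dens_gt0// gauss_densE.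
rewrite (funext (@gauss_densE n)) => x.
apply: (@continuousM R _ (fun=> gauss_peak n)); first exact: cst_continuous.
exact: continuous_gaussn.
Qed.

Lemma gauss_tempered_cst n c : gauss_tempered (fun _ : 'rV[R]_n => c).
Proof. by apply: gauss_dominated_cst; rewrite oppr_lt0 invr_gt0. Qed.

Lemma gauss_tempered_decay n (f : 'rV[R]_n -> R) : gauss_tempered f ->
  gauss_decay (fun x => f x * gauss_dens x).
Proof.
by move=> /gauss_dominatedM/(_ (gauss_bounded_dens n)); rewrite addNr.
Qed.

Definition gauss_mean (n : nat) (f : 'rV[R]_n -> R) : R :=
  iterint (fun x => f x * gauss_dens x).

Lemma eq_gauss_mean n (f g : 'rV[R]_n -> R) : f =1 g ->
  gauss_mean f = gauss_mean g.
Proof. by move=> /funext ->. Qed.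

Lemma gauss_meanZ n c (f : 'rV[R]_n -> R) : gauss_tempered f ->
  gauss_mean (fun x => c * f x) = c * gauss_mean f.
Proof.
move=> ft; rewrite /gauss_mean -iterintZ; last exact: gauss_tempered_decay.
by apply: eq_iterint => x; rewrite mulrA.
Qed.

Lemma gauss_meanD n (f g : 'rV[R]_n -> R) : gauss_tempered f ->
  gauss_tempered g ->
  gauss_mean (fun x => f x + g x) = gauss_mean f + gauss_mean g.
Proof.
move=> ft gt; rewrite /gauss_mean -iterintD; [|exact: gauss_tempered_decay..].
by apply: eq_iterint => x; rewrite mulrDl.
Qed.

Lemma cvg_gauss_mean n (f_ : nat -> 'rV[R]_n -> R) f C e : - 2^-1 < e ->
  (forall k, gauss_bounded C e (f_ k)) -> gauss_bounded C e f ->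
  (forall x, f_ k x @[k --> \oo] --> f x) ->
  gauss_mean (f_ k) @[k --> \oo] --> gauss_mean f.
Proof.
rewrite -subr_gt0 opprK => e0 f_C fC ff.
apply: (cvg_iterint (C := C * gauss_peak n) e0) => [k||x].
- exact: gauss_boundedM (gauss_bounded_dens n).
- exact: gauss_boundedM (gauss_bounded_dens n).
- by apply: cvgM; [exact: ff|exact: cvg_cst].
Qed.

Definition slice_mean (n : nat) (f : 'rV[R]_n.+1 -> R) (t : R) : R :=
  gauss_mean (slice f t).

Lemma normal_pdf_slice_mean n (f : 'rV[R]_n.+1 -> R) t : gauss_tempered f ->
  normal_pdf 0 1 t * slice_mean f t =
  iterint (fun y => f (row_cons t y) * gauss_dens (row_cons t y)).
Proof.
move=> /(gauss_dominated_slice t) ft.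
rewrite /slice_mean /gauss_mean -iterintZ; last exact: gauss_tempered_decay ft.
by apply: eq_iterint => y; rewrite gauss_dens_row_cons mulrCA.
Qed.

Lemma gauss_mean_ridge n (f : 'rV[R]_n.+1 -> R) (phi : R -> R) :
  gauss_tempered f ->
  gauss_mean (fun x => f x * phi (x 0 ord0)) =
  \int[mu]_t (phi t * (normal_pdf 0 1 t * slice_mean f t)).
Proof.
move=> ft; rewrite /gauss_mean iterintS; congr Rintegral; apply/funext => t.
rewrite normal_pdf_slice_mean// -iterintZ; last first.
  exact: gauss_dominated_slice t (gauss_tempered_decay ft).
by apply: eq_iterint => y; rewrite row_cons0 mulrAC mulrC.
Qed.

Lemma gauss_mean_slice n (f : 'rV[R]_n.+1 -> R) : gauss_tempered f ->
  gauss_mean f = \int[mu]_t (normal_pdf 0 1 t * slice_mean f t).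
Proof.
move=> ft; congr Rintegral; apply/funext => t.
by rewrite normal_pdf_slice_mean.
Qed.

Lemma Rintegral_normal_pdfZr (m c : R) : \int[mu]_t (normal_pdf m 1 t * c) = c.
Proof.
rewrite RintegralZr//; last exact: integrable_normal_pdf.
by rewrite /Rintegral integral_normal_pdf mul1r.
Qed.

Lemma gauss_mean_cst n c : gauss_mean (fun _ : 'rV[R]_n => c) = c.
Proof.
elim: n => [|n IH]; first by rewrite /gauss_mean iterint0 gauss_dens_rV0 mulr1.
rewrite gauss_mean_slice; last exact: gauss_tempered_cst.
by rewrite /slice_mean IH Rintegral_normal_pdfZr.
Qed.

Lemma gauss_meanBcst n (f : 'rV[R]_n -> R) c : gauss_tempered f ->
  gauss_mean (fun x => f x - c) = gauss_mean f - c.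
Proof.
move=> ft; rewrite gauss_meanD//; last exact: gauss_tempered_cst.
by rewrite gauss_mean_cst.
Qed.

Lemma continuous_slice_mean n (f : 'rV[R]_n.+1 -> R) : gauss_tempered f ->
  continuous (slice_mean f).
Proof.
move=> ft; have [C [e [e0 fC]]] := gauss_tempered_decay ft.
have -> : slice_mean f = (fun t => (normal_pdf 0 1 t)^-1 *
    iterint (fun y : 'rV[R]_n => f (row_cons t y) * gauss_dens (row_cons t y))).
  apply/funext => t; rewrite -normal_pdf_slice_mean// mulKf//.
  by rewrite gt_eqF// normal_pdf01_gt0.
move=> t; apply: (@continuousM R R (fun t => (normal_pdf 0 1 t)^-1));
  last exact: (continuous_iterint_slice e0 fC).
apply: continuousV; last exact: continuous_normal_pdf01.
by rewrite gt_eqF// normal_pdf01_gt0.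
Qed.

Lemma row_cons_line n (h s : R) (y : 'rV[R]_n) :
  row_cons (h + s) y = h *: delta_mx 0 ord0 + row_cons s y.
Proof.
have -> : h *: delta_mx 0 ord0 = row_cons h (0 : 'rV[R]_n).
  apply/rowP => i; case: (unliftP ord0 i) => [j|] ->.
    by rewrite row_consS !mxE mulr0.
  by rewrite row_cons0 !mxE mulr1.
by rewrite row_consD add0r.
Qed.

Lemma is_derive_row_cons n (f : 'rV[R]_n.+1 -> R) (s : R) y :
  derivable f (row_cons s y) (delta_mx 0 ord0) ->
  is_derive s 1 (fun t => f (row_cons t y)) (pd ord0 f (row_cons s y)).
Proof.
move=> df; have quotientE :
    (fun h : R => h^-1 *: (((fun t => f (row_cons t y)) \o shift s) (h *: 1) -
       f (row_cons s y))) =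
    (fun h : R => h^-1 *: ((f \o shift (row_cons s y)) (h *: delta_mx 0 ord0) -
       f (row_cons s y))).
  by apply/funext => h /=; rewrite row_cons_line [h *: 1]mulr1.
by apply: DeriveDef; rewrite /pd /derivable /derive quotientE.
Qed.

Lemma gauss_bounded_slice_unif n C e (f : 'rV[R]_n.+1 -> R) (r t : R) :
  `|t| <= r ->
  gauss_bounded C e f ->
  gauss_bounded (C * gauss1 (- `|e|) r) e (slice f t).
Proof.
move=> tr fC; apply: gauss_boundedW (gauss_bounded_slice t fC) => //.
rewrite ler_wpM2l ?(gauss_bounded_ge0 fC)// ler_expR -!mulNr opprK.
apply: (@le_trans _ _ (`|e| * t ^+ 2)).
  by rewrite ler_wpM2r ?sqr_ge0// -normrN ler_norm.
by rewrite ler_wpM2l// -[t ^+ 2]real_normK ?num_real// lerXn2r ?nnegrE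
  ?(le_trans _ tr).
Qed.

Lemma is_derive_slice_mean n (f : 'rV[R]_n.+1 -> R) :
  (forall x, derivable f x (delta_mx 0 ord0)) ->
  gauss_tempered f -> gauss_tempered (pd ord0 f) ->
  forall t : R, is_derive t 1 (slice_mean f) (slice_mean (pd ord0 f) t).
Proof.
move=> df f_temp Df_temp t.
have [C [e [e_gt fC DfC]]] := gauss_dominated_max2 f_temp Df_temp.
have e0 : 0 < e + 2^-1 by rewrite -(subr_gt0 (- 2^-1)) opprK in e_gt.
pose B := C * gauss1 (- `|e|) (`|t| + 1) * gauss_peak n.
have slice_bounded (h : 'rV[R]_n.+1 -> R) s : gauss_bounded C e h ->
    s \in `]t - 1, t + 1[ ->
    gauss_bounded B (e + 2^-1) (fun y => h (row_cons s y) * gauss_dens y).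
  move=> hC; rewrite in_itv/= => s_near.
  apply: gauss_boundedM (gauss_bounded_dens n).
  apply: gauss_bounded_slice_unif hC;
    rewrite -lerBlDl (le_trans (lerB_dist _ _))//.
  by rewrite ler_distl; lra.
apply: (is_derive_iterint (u := t - 1) (v := t + 1) (C := B) e0
  (f := fun t y => f (row_cons t y) * gauss_dens y)
  (Df := fun t y => pd ord0 f (row_cons t y) * gauss_dens y)).
- by move=> s; exact: slice_bounded.
- by move=> s; exact: slice_bounded.
- move=> s y _; have dfy := is_derive_row_cons (df (row_cons s y)).
  apply: is_derive_eq.
  by rewrite scaler0 add0r mulrC.
- by rewrite in_itv/= ltrBlDr !ltrDl ltr01.
Qed.

Lemma gauss_mean_ridge_orthogonal n (f : 'rV[R]_n.+1 -> R) (phi : R -> R) :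
  (forall x, derivable f x (delta_mx 0 ord0)) ->
  gauss_tempered f -> gauss_tempered (pd ord0 f) ->
  (forall t, slice_mean (pd ord0 f) t = 0) ->
  gauss_mean (fun x => (f x - gauss_mean f) * phi (x 0 ord0)) = 0.
Proof.
move=> df f_temp Df_temp Df0.
have slice_cst t : slice_mean f t = slice_mean f 0.
  by apply: is_derive_0_is_cst => s; rewrite -(Df0 s);
    exact: is_derive_slice_mean.
have meanE : gauss_mean f = slice_mean f 0.
  rewrite gauss_mean_slice//; under eq_fun do rewrite slice_cst.
  exact: Rintegral_normal_pdfZr.
have slice0 t : slice_mean (fun x => f x - gauss_mean f) t = 0.
  rewrite /slice_mean gauss_meanBcst; last exact: gauss_dominated_slice.
  by rewrite -/(slice_mean f t) slice_cst meanE subrr.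
rewrite gauss_mean_ridge;
  last exact: gauss_dominatedB f_temp (gauss_tempered_cst _ _).
under eq_fun do rewrite slice0 !mulr0.
by rewrite /Rintegral integral0.
Qed.

Lemma leb_int_EFin n (f : 'rV[R]_n -> R) : gauss_decay f ->
  leb_int (fun x => (f x)%:E) = (iterint f)%:E.
Proof.
elim: n f => [//|n IH] f f_decay; have [C [e [e0 fC]]] := f_decay.
rewrite iterintS EFin_Rintegral; last exact: integrable_iterint_slice fC.
apply: eq_integral => t _; rewrite mul1e.
exact: (IH _ (gauss_dominated_slice t f_decay)).
Qed.

Lemma gauss_exp_EFin n (f : 'rV[R]_n -> R) : gauss_tempered f ->
  gauss_exp (fun x => (f x)%:E) = (gauss_mean f)%:E.
Proof.
elim: n f => [|n IH] f f_temp;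
  first by rewrite /gauss_mean iterint0 gauss_dens_rV0 mulr1.
have [C [e [e0 fC]]] := gauss_tempered_decay f_temp.
rewrite /gauss_mean iterintS EFin_Rintegral;
  last exact: integrable_iterint_slice fC.
apply: eq_integral => t _; rewrite -normal_pdf_slice_mean// EFinM;
  congr (_ * _)%E.
exact: IH (gauss_dominated_slice t f_temp).
Qed.

End GaussianMean.

Section Positivity.
Variable R : realType.
Notation mu := (@lebesgue_measure R).

(* Measurability is not assumed, because wint integrates functions whose slices
   are not known to be measurable. *)
Lemma ge0_le_integral_nonmeasurable d (T : measurableType d)
    (nu : {measure set T -> \bar R}) (f g : T -> \bar R) :
  (forall t, 0 <= f t)%E -> (forall t, f t <= g t)%E ->
  (\int[nu]_t f t <= \int[nu]_t g t)%E.
Proof.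
move=> f0 fg; have g0 t : (0 <= g t)%E by exact: le_trans (fg t).
rewrite !ge0_integralTE//; apply: ereal_sup_le => _ [h hf <-].
by exists h => // t; exact: le_trans (fg t).
Qed.

Lemma ball_row_cons n r (x : 'rV[R]_n.+1) t y :
  ball (x 0 ord0) r t -> ball (col' ord0 x) r y -> ball x r (row_cons t y).
Proof.
move=> xt [r0 xy]; split=> // i j; rewrite ord1.
case: (unliftP ord0 j) => [k|] ->; last by rewrite row_cons0.
by rewrite row_consS; have := xy 0 k; rewrite mxE.
Qed.

Section WeightedIntegral.
Variable w : R -> R.
Hypotheses (w_continuous : continuous w) (w_gt0 : forall t, 0 < w t).

Lemma wint_ge0 n (f : 'rV[R]_n -> \bar R) :
  (forall x, 0 <= f x)%E -> (0 <= wint w f)%E.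
Proof.
elim: n f => [|n IH] f f0 //=.
by apply: integral_ge0 => t _; rewrite mule_ge0 ?lee_fin ?(ltW (w_gt0 _))//;
  exact: IH.
Qed.

Lemma wint_ge_ball n (x0 : 'rV[R]_n) r : 0 < r -> exists2 k, 0 < k &
  forall (f : 'rV[R]_n -> \bar R) c, (forall x, 0 <= f x)%E -> 0 <= c ->
    (forall x, ball x0 r x -> (c%:E <= f x)%E) -> ((c * k)%:E <= wint w f)%E.
Proof.
elim: n x0 => [|n IH] x0 r0.
  by exists 1 => // f c _ _ cf; rewrite mulr1; apply: cf; split=> // i -[].
have [k k0 wint_ge_k] := IH (col' ord0 x0) r0.
pose a := x0 0 ord0; have wa0 : 0 < w a / 2 by rewrite divr_gt0.
have : \forall t \near a, w a / 2 < w t.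
  by apply: nbhs_continuous_gt => //; have := w_gt0 a; lra.
move=> /nbhs_ballP[s /= s0 w_gt]; pose q := Num.min r s.
have q0 : 0 < q by rewrite lt_min r0.
exists (k * (w a / 2) * (q *+ 2)) => [|f c f0 c0 cf].
  by rewrite !mulr_gt0// pmulrn_lgt0.
pose K := w a / 2 * (c * k).
have K0 : 0 <= K by rewrite !mulr_ge0// ltW.
have -> : ((c * (k * (w a / 2) * (q *+ 2)))%:E =
    \int[mu]_(t in ball a q) (cst K%:E t))%E.
  rewrite integral_cst//; last exact: measurable_ball.
  rewrite [X in (_ * X)%E](lebesgue_measure_ball a (ltW q0)) -EFinM /K.
  by congr EFin; ring.
rewrite integral_mkcond /=; apply: ge0_le_integral_nonmeasurable => t;
  rewrite /patch.
  by case: ifP => // _; rewrite lee_fin.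
case: ifPn => [/set_mem tq|_];
  last by rewrite mule_ge0 ?lee_fin ?(ltW (w_gt0 t))// wint_ge0.
rewrite /K EFinM lee_pmul ?lee_fin ?(ltW wa0) ?mulr_ge0 ?(ltW k0)//.
  by apply: ltW; apply: (w_gt t); apply: le_ball tq; rewrite ge_min lexx orbT.
apply: wint_ge_k => // y ry; apply: cf; apply: ball_row_cons => //.
by apply: le_ball tq; rewrite ge_min lexx.
Qed.

Lemma wint_gt0 n (f : 'rV[R]_n -> \bar R) (x0 : 'rV[R]_n) c :
  (forall x, 0 <= f x)%E -> 0 < c ->
  (\forall x \near x0, (c%:E <= f x)%E) -> (0 < wint w f)%E.
Proof.
move=> f0 c0 /nbhs_ballP[r /= r0 cf].
have [k k0 /(_ f c f0 (ltW c0) cf)] := wint_ge_ball x0 r0.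
by apply: lt_le_trans; rewrite lte_fin mulr_gt0.
Qed.

Lemma wint_continuous_eq0 n (f : 'rV[R]_n -> R) : continuous f ->
  (forall x, 0 <= f x) -> wint w (fun x => (f x)%:E) = 0%E -> forall x, f x = 0.
Proof.
move=> cf f0 wf0 x; apply/eqP; rewrite eq_le f0 andbT leNgt; apply/negP => fx0.
suff : (0 < wint w (fun x => (f x)%:E))%E by rewrite wf0 ltxx.
apply: (@wint_gt0 _ _ x (f x / 2)); rewrite ?divr_gt0//.
have : \forall y \near x, f x / 2 < f y by apply: nbhs_continuous_gt => //; lra.
by apply: filterS => y; rewrite lee_fin => /ltW.
Qed.

End WeightedIntegral.

Lemma leb_ae_closed n (P : 'rV[R]_n -> Prop) : closed [set x | P x] ->
  leb_ae P ->
  forall x, P x.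
Proof.
move=> clP aeP x; apply: contrapT => nPx.
suff : (0 < leb_int (fun x => (\1_(~` [set y | P y]) x : R)%:E))%E
  by rewrite aeP ltxx.
apply: (@wint_gt0 _ _ _ _ _ x 1) => [|t|y||].
- by move=> t; exact: cst_continuous.
- exact: ltr01.
- by rewrite lee_fin.
- exact: ltr01.
have : nbhs x (~` [set y | P y]) by apply: open_nbhs_nbhs; split=> //;
  exact: closed_openC.
by apply: filterS => y nPy; rewrite indicE mem_set.
Qed.

End Positivity.

Section CosinePowers.
Variable R : realType.

Lemma normr_sin_le (t : R) : `|sin t| <= `|t|.
Proof.
wlog t0 : t / 0 <= t.
  move=> sin_le; have [/sin_le//|/ltW t0] := leP 0 t.
  by rewrite -normrN -[`|t|]normrN -sinN; apply: sin_le; rewrite oppr_ge0.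
have csin : {within `[0, t], continuous (@sin R)}.
  by apply: continuous_subspaceT => x; exact: continuous_sin.
have [c _] := MVT_segment t0 (fun x _ => is_derive_sin x) csin.
by rewrite sin0 !subr0 => ->; rewrite normrM ler_piMl// cos_max.
Qed.

Lemma cos_sin_half (z : R) : cos z = 1 - 2 * sin (z / 2) ^+ 2.
Proof.
by rewrite {1}(splitr z) cosD -!expr2; have := cos2Dsin2 (z / 2); lra.
Qed.

Lemma subr_sin_le (t : R) : 0 <= t -> t - sin t <= t ^+ 3 / 2.
Proof.
move=> t0.
have dsub x : x \in `]0, t[ ->
  is_derive x 1 (fun x : R => x - sin x) (1 - cos x).
  by move=> _; apply: is_deriveB.
have csub : {within `[0, t], continuous (fun x : R => x - sin x)}.
  apply: continuous_subspaceT => x; apply: continuousB; first exact: cvg_id.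
  exact: continuous_sin.
have [c] := MVT_segment t0 dsub csub.
rewrite in_itv/= => /andP[c0 ct]; rewrite sin0 !subr0 => ->.
rewrite exprSr mulrAC ler_wpM2r// cos_sin_half opprB addrC subrK.
have sin2_le : sin (c / 2) ^+ 2 <= (c / 2) ^+ 2.
  rewrite -[leLHS]real_normK ?num_real// -[leRHS]real_normK ?num_real//.
  by rewrite lerXn2r ?nnegrE// normr_sin_le.
have c2_le : c ^+ 2 <= t ^+ 2 by rewrite lerXn2r ?nnegrE.
by rewrite expr_div_n in sin2_le; lra.
Qed.

Lemma normr_cos_taylor2_le (z : R) : `|cos z - (1 - z ^+ 2 / 2)| <= z ^+ 4 / 8.
Proof.
wlog z0 : z / 0 <= z.
  move=> cos_le; have [/cos_le//|/ltW z0] := leP 0 z.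
  have := cos_le (- z); rewrite cosN sqrrN (_ : (- z) ^+ 4 = z ^+ 4);
    last by ring.
  by rewrite oppr_ge0; exact.
pose t := z / 2; have t0 : 0 <= t by rewrite divr_ge0.
have /ler_normlP[sin_ge sin_le] : `|sin t| <= t.
  by rewrite (le_trans (normr_sin_le t))// ger0_norm.
have -> : cos z - (1 - z ^+ 2 / 2) = 2 * ((t - sin t) * (t + sin t)).
  by rewrite cos_sin_half -/t /t; field.
have sub_ge0 : 0 <= t - sin t by rewrite subr_ge0.
have add_ge0 : 0 <= t + sin t by rewrite -lerBlDr sub0r.
rewrite ger0_norm; last by rewrite !mulr_ge0.
have -> : z ^+ 4 / 8 = 2 * (t ^+ 3 / 2 * (t + t)) by rewrite /t; field.
by rewrite ler_pM2l// ler_pM ?subr_sin_le// lerD2l.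
Qed.

Lemma normr_expRN_taylor1_le (u : R) : 0 <= u ->
  `|expR (- u) - (1 - u)| <= u ^+ 2.
Proof.
move=> u0; rewrite ger0_norm; last by rewrite subr_ge0 expR_ge1Dx.
have expRN_le : (1 + u) * expR (- u) <= 1.
  by rewrite expRN ler_pdivrMr ?expR_gt0// mul1r expR_ge1Dx.
rewrite lerBlDr -(ler_pM2l (_ : 0 < 1 + u)); last by rewrite ltr_wpDr.
apply: (le_trans expRN_le); have : 0 <= u ^+ 3 by rewrite exprn_ge0.
nra.
Qed.

Lemma normr_cosB_expR_le (z : R) : `|cos z - expR (- (z ^+ 2 / 2))| <= z ^+ 4.
Proof.
have cos_le := normr_cos_taylor2_le z.
have expR_le : `|expR (- (z ^+ 2 / 2)) - (1 - z ^+ 2 / 2)| <= (z ^+ 2 / 2) ^+ 2.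
  by apply: normr_expRN_taylor1_le; rewrite divr_ge0// sqr_ge0.
rewrite distrC in expR_le.
rewrite (le_trans (ler_distD (1 - z ^+ 2 / 2) _ _))//
  (le_trans (lerD cos_le expR_le))//.
have : 0 <= z ^+ 4 by rewrite exprn_even_ge0.
have -> : (z ^+ 2 / 2) ^+ 2 = z ^+ 4 / 4 by field.
lra.
Qed.

Lemma normr_subX_le (a b : R) m : `|a| <= 1 -> `|b| <= 1 ->
  `|a ^+ m - b ^+ m| <= m%:R * `|a - b|.
Proof.
move=> a1 b1; elim: m => [|m IH]; first by rewrite !expr0 subrr normr0 mul0r.
have -> : a ^+ m.+1 - b ^+ m.+1 = a * (a ^+ m - b ^+ m) + (a - b) * b ^+ m.
  by rewrite !exprS; ring.
apply: (le_trans (ler_normD _ _)); rewrite -natr1 [leRHS]mulrDl mul1r lerD//.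
  by rewrite normrM (le_trans _ IH)// ler_piMl.
by rewrite normrM ler_piMr// normrX exprn_ile1.
Qed.

Lemma cvg_cosX (y : R) :
  cos (y / Num.sqrt k.+1%:R) ^+ k.+1 @[k --> \oo] --> expR (- (y ^+ 2 / 2)).
Proof.
apply/cvgrPdist_le => e e0; near=> k; rewrite distrC.
have k0 : k.+1%:R != 0 :> R by rewrite pnatr_eq0.
set z := y / _;
  have z2 : z ^+ 2 = y ^+ 2 / k.+1%:R by rewrite /z expr_div_n sqr_sqrtr.
have -> : expR (- (y ^+ 2 / 2)) = expR (- (z ^+ 2 / 2)) ^+ k.+1.
  by rewrite -expRM_natl; congr expR; rewrite z2; field; rewrite nat1r.
apply: (le_trans (normr_subX_le _ _ _)); first exact: cos_max.
  by rewrite ger0_norm ?expR_ge0// expR_le1 oppr_le0 divr_ge0// sqr_ge0.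
apply: (@le_trans _ _ (k.+1%:R * z ^+ 4));
  first by rewrite ler_pM2l// normr_cosB_expR_le.
have -> : k.+1%:R * z ^+ 4 = y ^+ 4 / k.+1%:R.
  by rewrite -[4%N]/(2 * 2)%N !exprM z2; field; rewrite nat1r.
rewrite ler_pdivrMr// mulrC -ler_pdivrMr//.
apply: (@le_trans _ _ k%:R); last by rewrite ler_nat.
by near: k; exact: nbhs_infty_ger.
Unshelve. all: by end_near. Qed.

End CosinePowers.

Section CosineOrthogonality.
Variable R : realType.

Lemma continuous_cos_dot n (w : 'rV[R]_n) b :
  continuous (fun x => cos (dot x w + b)).
Proof.
move=> x; apply: continuous_comp; last exact: continuous_cos.
by apply: continuousD; [exact: continuous_dot|exact: cst_continuous].
Qed.

Lemma cvg_gauss_mean_cos n (f : 'rV[R]_n -> R) (w_ : nat -> 'rV[R]_n) w b :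
  gauss_tempered f -> w_ k @[k --> \oo] --> w ->
  gauss_mean (fun x => f x * cos (dot x (w_ k) + b)) @[k --> \oo] -->
  gauss_mean (fun x => f x * cos (dot x w + b)).
Proof.
move=> [C [e [e_gt fC]]] w_cvg.
have cos_bounded v : gauss_bounded (C * 1) e (fun x => f x * cos (dot x v + b)).
  apply: gauss_bounded_mul_bounded => // [|x]; first exact: continuous_cos_dot.
  exact: cos_max.
apply: (cvg_gauss_mean e_gt) => // x; apply: cvgM; first exact: cvg_cst.
apply: (@continuous_cvg _ _ _ _ _ (fun k => dot x (w_ k) + b) cos).
  exact: continuous_cos.
apply: cvgD; last exact: cvg_cst.
rewrite dotC; under eq_fun do rewrite dotC.
by apply: (@continuous_cvg _ _ _ _ _ w_ (fun v => dot v x)) => //;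
  exact: continuous_dot.
Qed.

Definition cos_orthogonal (n : nat) (g : 'rV[R]_n -> R) :=
  forall w b, gauss_mean (fun x => g x * cos (dot x w + b)) = 0.

Lemma gauss_tempered_mul_cos n (g : 'rV[R]_n -> R) w b : gauss_tempered g ->
  gauss_tempered (fun x => g x * cos (dot x w + b)).
Proof.
move=> gt; apply: (gauss_dominated_mul_bounded (B := 1)) => // [|x].
  exact: continuous_cos_dot.
exact: cos_max.
Qed.

Lemma cos_orthogonal_mul_cos n (g : 'rV[R]_n -> R) v c : gauss_tempered g ->
  cos_orthogonal g -> cos_orthogonal (fun x => g x * cos (dot x v + c)).
Proof.
move=> gt g_orth w b.
have -> : gauss_mean (fun x => g x * cos (dot x v + c) * cos (dot x w + b)) =
    gauss_mean (fun x => 2^-1 * (g x * cos (dot x (w + v) + (b + c))) +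
                         2^-1 * (g x * cos (dot x (w - v) + (b - c)))).
  apply: eq_gauss_mean => x; rewrite !dotDr dotNr.
  rewrite (addrACA (dot x w)) [_ - _ + (b - c)]addrACA -opprD.
  by move: (dot x w + b) (dot x v + c) => s t; rewrite cosD cosB; field.
by rewrite gauss_meanD ?gauss_meanZ ?g_orth ?mulr0 ?addr0//;
  do ?apply: gauss_dominatedZ; exact: gauss_tempered_mul_cos.
Qed.

Lemma cos_orthogonal_mul_prod n (g : 'rV[R]_n -> R) (I : Type) (s : seq I) v c :
  gauss_tempered g -> cos_orthogonal g ->
  cos_orthogonal (fun x => g x * \prod_(i <- s) cos (dot x (v i) + c i)).
Proof.
elim: s g => [|i s IH] g gt g_orth.
  by under eq_fun do rewrite big_nil mulr1.
under eq_fun do rewrite big_cons mulrA.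
by apply: IH; [exact: gauss_tempered_mul_cos|exact: cos_orthogonal_mul_cos].
Qed.

Lemma cos_orthogonal_gauss_mean n (g : 'rV[R]_n -> R) : cos_orthogonal g ->
  gauss_mean g = 0.
Proof.
move=> /(_ 0 0); under eq_gauss_mean => x do
  rewrite -(scale0r (0 : 'rV[R]_n)) dotZr mul0r addr0 cos0 mulr1.
exact.
Qed.

Lemma cvg_prod_cosX n (q : R) (x a : 'rV[R]_n) :
  \prod_(j < n) cos (q * (x - a) 0 j / Num.sqrt k.+1%:R) ^+ k.+1 @[k --> \oo]
    --> gaussn (q ^+ 2 / 2) (x - a).
Proof.
have -> : gaussn (q ^+ 2 / 2) (x - a) =
  \prod_(j < n) expR (- ((q * (x - a) 0 j) ^+ 2 / 2)).
  rewrite -expR_sum sumrN /gaussn /sqnorm mulr_sumr; congr (expR (- _)).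
  by apply: eq_bigr => j _; rewrite exprMn mulrAC.
apply: cvg_big => [|j _]; [exact: mul_continuous|exact: cvg_cosX].
Qed.

(* The product formula for cosines puts all products of cosines in the orthogonal
   complement of g; cos(y/sqrt k)^k tends to exp(-y^2/2). *)
Lemma gauss_mean_mul_gaussn_eq0 n (g : 'rV[R]_n -> R) (q : R) (a : 'rV[R]_n) :
  gauss_tempered g -> cos_orthogonal g ->
  gauss_mean (fun x => g x * gaussn (q ^+ 2 / 2) (x - a)) = 0.
Proof.
move=> gt g_orth; have [C [e [e_gt gC]]] := gt.
pose q_ k : R := q / Num.sqrt k.+1%:R.
pose phase k (p : 'I_n * 'I_k.+1) (x : 'rV[R]_n) :=
  dot x (q_ k *: delta_mx 0 p.1) + - (q_ k * a 0 p.1).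
pose P k (x : 'rV[R]_n) := \prod_p cos (@phase k p x).
have P_orth k : gauss_mean (fun x => g x * P k x) = 0.
  exact/cos_orthogonal_gauss_mean/cos_orthogonal_mul_prod.
have P_le1 k x : `|P k x| <= 1.
  by rewrite normr_prod prodr_ile1// => p _; rewrite normr_ge0 cos_max.
have PE k x : P k x =
    \prod_(j < n) cos (q * (x - a) 0 j / Num.sqrt k.+1%:R) ^+ k.+1.
  rewrite /P -(pair_bigA _ (fun j i => cos (@phase k (j, i) x)));
    apply: eq_bigr => j _.
  rewrite /phase /= prodr_const card_ord dotZr dot_delta !mxE /q_.
  by congr (cos _ ^+ _); ring.
suff : gauss_mean (fun x => g x * P k x) @[k --> \oo] -->
    gauss_mean (fun x => g x * gaussn (q ^+ 2 / 2) (x - a)).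
  under eq_fun do rewrite P_orth.
  exact: cvgn_cst_eq.
apply: (cvg_gauss_mean (C := C * 1) e_gt) => [k||x].
- apply: gauss_bounded_mul_bounded => //; apply: continuous_big => [|p _].
    exact: mul_continuous.
  exact: continuous_cos_dot.
- apply: gauss_bounded_mul_bounded => // [|x]; first exact: continuous_gaussnB.
  by rewrite normr_gaussn_le1// divr_ge0// sqr_ge0.
- apply: cvgM; first exact: cvg_cst.
  by under eq_fun do rewrite PE; exact: cvg_prod_cosX.
Qed.

Lemma iterint_dilate n (r : R) (x : 'rV[R]_n) (F : 'rV[R]_n -> R) : r != 0 ->
  gauss_decay F ->
  `|r| ^+ n * iterint (fun z => F (r *: z + x)) = iterint F.
Proof.
move=> r0 F_decay; have ur : (r%:M : 'M[R]_n) \in unitmx.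
  by rewrite unitmxE det_scalar unitfE expf_neq0.
have Fx_decay := gauss_decay_translate x F_decay.
have scaleE z : r *: z = z *m r%:M by rewrite mul_mx_scalar.
under eq_iterint do rewrite scaleE.
rewrite -(iterint_translate x F_decay) -(iterint_mulmx ur Fx_decay) det_scalar
  normrX.
by rewrite iterintZ//; exact: gauss_decay_mulmx ur Fx_decay.
Qed.

Lemma cvg_gauss_mean_dilate n (F : 'rV[R]_n -> R) B (x : 'rV[R]_n) :
  continuous F ->
  (forall z, `|F z| <= B) ->
  gauss_mean (fun z => F (k.+1%:R^-1 *: z + x)) @[k --> \oo] --> F x.
Proof.
move=> cF FB; rewrite -[X in _ --> X](@gauss_mean_cst _ n).
apply: (cvg_gauss_mean (C := B) (e := 0)) => [|k||z].
- by rewrite oppr_lt0 invr_gt0.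
- split=> [z|z]; last by rewrite gaussn0 mulr1.
  apply: continuous_comp; last exact: cF.
  have := @continuous_affine R 1 n n (k.+1%:R^-1)%:M x z.
  by under eq_fun do rewrite mul_mx_scalar.
- by split=> z; [exact: cst_continuous|rewrite gaussn0 mulr1].
apply: (@continuous_cvg _ _ _ _ _ (fun k => k.+1%:R^-1 *: z + x) F);
  first exact: cF.
apply: cvg_mx => i j; under eq_fun do rewrite !mxE.
have : k.+1%:R^-1 * z i j + x i j @[k --> \oo] --> 0 * z i j + x i j.
  apply: cvgD; last exact: cvg_cst.
  by apply: cvgM; [exact: cvg_harmonic|exact: cvg_cst].
by rewrite mul0r add0r.
Qed.

Lemma gaussn_orthogonal_eq0 n (F : 'rV[R]_n -> R) (x : 'rV[R]_n) :
  gauss_decay F ->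
  (forall q : R, 0 < q ->
     iterint (fun z => F z * gaussn (q ^+ 2 / 2) (z - x)) = 0) ->
  F x = 0.
Proof.
move=> F_decay F_orth; have [C [e [e0 fC]]] := F_decay.
have [cF F_le] := gauss_boundedW (lexx C) (ltW e0) fC.
have FC z : `|F z| <= C by rewrite (le_trans (F_le z))// gaussn0 mulr1.
have dilate0 k : gauss_mean (fun z => F (k.+1%:R^-1 *: z + x)) = 0.
  pose r : R := k.+1%:R^-1; have r0 : r != 0 by rewrite invr_neq0// pnatr_eq0.
  pose h z := gauss_peak R n * (F z * gaussn (k.+1%:R ^+ 2 / 2) (z - x)).
  have F_bump_decay :
    gauss_decay (fun z => F z * gaussn (k.+1%:R ^+ 2 / 2) (z - x)).
    apply: (gauss_dominated_mul_bounded (B := 1)) => // [|z].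
      exact: continuous_gaussnB.
    by rewrite normr_gaussn_le1// divr_ge0// sqr_ge0.
  have h_decay : gauss_decay h by exact: gauss_dominatedZ.
  have h0 : iterint h = 0 by rewrite iterintZ// F_orth// mulr0.
  have /eqP := iterint_dilate x r0 h_decay.
  rewrite h0 mulf_eq0 expf_eq0 normr_eq0 (negbTE r0) andbF /= => /eqP <-.
  apply: eq_iterint => z; rewrite /h addrK gauss_densE mulrCA;
    congr (_ * (_ * _)).
  by rewrite /gaussn sqnormZ; congr expR; rewrite /r; field; rewrite nat1r.
have := @cvg_gauss_mean_dilate n F C x cF FC; under eq_fun do rewrite dilate0.
exact: cvgn_cst_eq.
Qed.

Theorem cos_orthogonal_eq0 n (g : 'rV[R]_n -> R) : gauss_tempered g ->
  cos_orthogonal g -> forall x, g x = 0.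
Proof.
move=> gt g_orth x;
  have := @gaussn_orthogonal_eq0 n _ x (gauss_tempered_decay gt).
move=> /(_ _)/eqP; rewrite mulf_eq0 [X in _ || X]gt_eqF ?gauss_dens_gt0// orbF.
move=> g_eq0; apply/eqP/g_eq0 => q _;
  rewrite -[RHS](gauss_mean_mul_gaussn_eq0 q x gt g_orth).
by apply: eq_iterint => z; rewrite mulrAC.
Qed.

End CosineOrthogonality.

Section OrthogonalMatrices.
Variables (R : realType) (n : nat).
Implicit Types (M N : 'M[R]_n) (x u v : 'rV[R]_n).

Lemma orth_mx_mulT M : orth_mx M -> M *m M^T = 1%:M.
Proof. exact: mulmx1C. Qed.

Lemma orth_mx_unitmx M : orth_mx M -> M \in unitmx.
Proof. by case/mulmx1_unit. Qed.

Lemma orth_mx1 : orth_mx (1%:M : 'M[R]_n).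
Proof. by rewrite /orth_mx trmx1 mulmx1. Qed.

Lemma orth_mx_tr M : orth_mx M -> orth_mx M^T.
Proof. by move=> /orth_mx_mulT; rewrite /orth_mx trmxK. Qed.

Lemma orth_mx_mul M N : orth_mx M -> orth_mx N -> orth_mx (M *m N).
Proof.
by rewrite /orth_mx => oM oN; rewrite trmx_mul -mulmxA (mulmxA M^T) oM mul1mx.
Qed.

Lemma orth_mx_det M : orth_mx M -> `|\det M| = 1.
Proof.
move=> /(congr1 determinant); rewrite det_mulmx det_tr det1 => detM2.
by apply/eqP; rewrite -(@eqrXn2 _ 2)// expr1n -normrX expr2 detM2 normr1.
Qed.

Lemma dot_orth M x v : orth_mx M -> dot (x *m M) (v *m M) = dot x v.
Proof.
by move=> /orth_mx_mulT oM; rewrite /dot trmx_mul -mulmxA (mulmxA M) oM mul1mx.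
Qed.

Lemma sqnorm_orth M x : orth_mx M -> sqnorm (x *m M) = sqnorm x.
Proof. by move=> oM; rewrite !sqnormE dot_orth. Qed.

Lemma orth_mx_entry_le1 M i j : orth_mx M -> `|M i j| <= 1.
Proof.
move=> /(congr1 (fun A : 'M[R]_n => A j j));
  rewrite !mxE eqxx mulr1n => col_norm.
rewrite -(@expr_le1 _ 2)// real_normK ?num_real// -col_norm (bigD1 i)//= mxE
  -expr2.
by rewrite lerDl sumr_ge0// => k _; rewrite mxE -expr2 sqr_ge0.
Qed.

(* The identity matrix when v = 0, since 2 / 0 = 0. *)
Definition householder v : 'M[R]_n := 1%:M - (2 / sqnorm v) *: (v^T *m v).

Lemma householder_orth v : orth_mx (householder v).
Proof.
have [v0|v0] := eqVneq (sqnorm v) 0.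
  by rewrite /householder v0 invr0 mulr0 scale0r subr0; exact: orth_mx1.
have sym : (householder v)^T = householder v.
  by rewrite /householder linearB linearZ/= trmx1 trmx_mul trmxK.
have vvT : v *m v^T = (sqnorm v)%:M by rewrite [LHS]mx11_scalar sqnormE.
have idem : (v^T *m v) *m (v^T *m v) = sqnorm v *: (v^T *m v).
  by rewrite mulmxA -(mulmxA v^T) vvT mul_mx_scalar -scalemxAl.
rewrite /orth_mx sym /householder mulmxBr mulmx1 mulmxBl mul1mx.
rewrite -scalemxAl -scalemxAr idem !scalerA.
rewrite (_ : 2 / _ * (_ / _) * _ = 2 / sqnorm v + 2 / sqnorm v); last by field.
by rewrite scalerDl opprB addrK subrK.
Qed.

Lemma householder_swap u w : sqnorm u = sqnorm w ->
  w *m householder (u - w) = u.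
Proof.
move=> uw; pose v := u - w.
have dot_wv : dot w v = - (sqnorm v / 2).
  have -> : dot w v = dot w u - sqnorm w by rewrite dotDr dotNr sqnormE.
  have -> : sqnorm v = 2 * (sqnorm w - dot w u).
    rewrite /v !sqnormE dotDr dotNr (dotC _ u) (dotC _ w) !dotDr !dotNr
      (dotC u w).
    by rewrite -!sqnormE uw; ring.
  by field.
have -> : w *m householder v = w - (2 / sqnorm v * dot w v) *: v.
  rewrite mulmxBr mulmx1 -scalemxAr mulmxA.
  by rewrite [w *m v^T]mx11_scalar mul_scalar_mx scalerA.
have [v0|v0] := eqVneq (sqnorm v) 0.
  have /eqP : v = 0 by exact: sqnorm_eq0.
  by rewrite subr_eq0 => /eqP <-; rewrite v0 invr0 mulr0 mul0r scale0r subr0.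
rewrite dot_wv (_ : _ * _ = -1); last by field.
by rewrite scaleN1r opprK addrC subrK.
Qed.

End OrthogonalMatrices.

Lemma orth_mx_row0 (R : realType) n (u : 'rV[R]_n.+1) : sqnorm u = 1 ->
  exists2 M : 'M[R]_n.+1, orth_mx M & row 0 M = u.
Proof.
move=> u1; exists (householder (u - delta_mx 0 0));
  first exact: householder_orth.
by rewrite rowE householder_swap// u1 sqnormE dot_delta mxE !eqxx.
Qed.

Lemma rV_scale_orth_row0 (R : realType) n (w : 'rV[R]_n.+1) :
  exists s, exists2 M, orth_mx M & w = s *: row 0 M.
Proof.
have [w0|w0] := eqVneq (enorm w) 0.
  exists 0, 1%:M; first exact: orth_mx1.
  by rewrite scale0r; apply: sqnorm_eq0; rewrite -sqr_enorm w0 expr0n.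
have [|M oM rowM] := @orth_mx_row0 R n ((enorm w)^-1 *: w).
  by rewrite sqnormZ -sqr_enorm exprVn mulVf// expf_neq0.
by exists (enorm w), M => //; rewrite rowM scalerA mulfV// scale1r.
Qed.

Lemma gauss_mean_orth (R : realType) n (f : 'rV[R]_n -> R) (M : 'M[R]_n) :
  orth_mx M ->
  gauss_tempered f -> gauss_mean (fun x => f (x *m M)) = gauss_mean f.
Proof.
move=> oM ft; have f_decay := gauss_tempered_decay ft.
rewrite /gauss_mean -(iterint_mulmx (orth_mx_unitmx oM) f_decay);
  apply: eq_iterint => x.
by rewrite orth_mx_det// mul1r /gauss_dens sqnorm_orth.
Qed.

Section HaarMeasure.
Variables (R : realType) (n : nat) (mu : {measure set (MBorel R n) -> \bar R}).

Lemma countable_net (m k : nat) (P : set 'M[R]_(m, k)) (d : R) : 0 < d ->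
  P !=set0 ->
  exists2 s : nat -> 'M[R]_(m, k), (forall l, P (s l)) &
    forall M, P M -> exists l, forall i j, `|M i j - s l i j| < d.
Proof.
move=> d0 [M0 PM0].
pose cell (M : 'M[R]_(m, k)) :
  'M[int]_(m, k) := map_mx (fun t => Num.floor (t * d^-1)) M.
pose s l :=
  if unpickle l is Some z then xget M0 [set M | P M /\ cell M = z] else M0.
exists s => [l|M PM].
  by rewrite /s; case: unpickle => [z|//]; case: xgetP => // M _ [].
exists (pickle (cell M)) => i j.
have : cell (s (pickle (cell M))) = cell M.
  by rewrite /s pickleK; case: xgetP => [N _ []|/(_ M)[]].
move=> /(congr1 (fun A : 'M[int]_(m, k) => A i j));
  rewrite !mxE -[X in _ < X]invrK => /esym.
by apply: dist_eq_floor; rewrite invr_gt0.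
Qed.

Lemma closed_orth_mx : closed [set M : 'M[R]_n | orth_mx M].
Proof.
have gram_continuous : continuous (fun M : 'M[R]_n => M^T *m M).
  apply: continuous_mulmx => [|M]; last exact: cvg_id.
  by apply: continuous_mx => i j; under eq_fun do rewrite mxE;
    exact: coord_continuous.
apply: (@closed_comp _ _ (fun M : 'M[R]_n => M^T *m M) [set 1%:M]) => [M _|].
  exact: gram_continuous.
exact/accessible_closed_set1/hausdorff_accessible/norm_hausdorff.
Qed.

Lemma MBorel_open (U : set 'M[R]_n) : open U ->
  measurable (U : set (MBorel R n)).
Proof. exact: sub_sigma_algebra. Qed.

Lemma haar_negligible_translate (Q : 'M[R]_n) (U : set 'M[R]_n) :
  is_haar_On mu ->
  orth_mx Q -> open U -> mu U = 0%E ->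
    mu.-negligible [set M : MBorel R n | U (Q *m M)].
Proof.
move=> [_ _ invariant] oQ oU U0; apply/negligibleP; last first.
  by rewrite -[RHS]U0; apply: invariant => //; exact: MBorel_open.
apply: MBorel_open;
  apply: (@open_comp _ _ (fun M : 'M[R]_n => Q *m M)) => // M _.
by apply: (@continuous_mulmx _ _ _ _ _ (fun=> Q) id) => N;
  [exact: cst_continuous|exact: cvg_id].
Qed.

Lemma dist_orth_mulmx_lt (Q M N : 'M[R]_n) (r : R) : orth_mx Q -> 0 < r ->
  (forall i j, `|M i j - N i j| < r / n.+1%:R) -> ball (Q *m N) r (Q *m M).
Proof.
move=> oQ r0 MN; split=> // i j; rewrite /ball/= distrC.
have -> : (Q *m M) i j - (Q *m N) i j = \sum_k Q i k * (M k j - N k j).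
  by rewrite !mxE -sumrB; apply: eq_bigr => k _; rewrite mulrBr.
apply: (le_lt_trans (ler_norm_sum _ _ _)).
apply: (@le_lt_trans _ _ (\sum_(k < n) r / n.+1%:R)).
  apply: ler_sum => k _; rewrite normrM -[leRHS]mul1r.
  by rewrite ler_pM ?orth_mx_entry_le1// ltW.
by rewrite sumr_const card_ord -[_ *+ n]mulr_natl mulrCA gtr_pMr//
  ltr_pdivrMr// mul1r ltr_nat.
Qed.

(* Countably many left translates of a neighbourhood of an orthogonal matrix cover
   O(n), so that this neighbourhood cannot be negligible. *)
Lemma haar_ae_dense (P : 'M[R]_n -> Prop) : is_haar_On mu ->
  {ae mu, forall M : MBorel R n, P M} ->
  [set M | orth_mx M] `<=` closure [set M | orth_mx M /\ P M].
Proof.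
move=> haar aeP M0 oM0 B /nbhs_interior M0B.
have [mu1 muN _] := haar.
apply: contrapT => disjoint; pose U := B°;
  have oU : open U by exact: open_interior.
have nN : mu.-negligible [set M : MBorel R n | ~ orth_mx M].
  by apply/negligibleP => //; apply: MBorel_open; apply: closed_openC;
    exact: closed_orth_mx.
have U0 : mu U = 0%E.
  apply: measure_negligible; first exact: MBorel_open.
  apply: negligibleS (negligibleU nN aeP) => M UM.
  have [oM|] := pselect (orth_mx M); last by left.
  right => PM; apply: disjoint; exists M; split=> //.
  exact: interior_subset UM.
have /nbhs_ballP[r /= r0 ball_U] := M0B.
have [s os s_net] := @countable_net n n [set M | orth_mx M] (r / n.+1%:R)
  (divr_gt0 r0 (ltr0Sn _ _)) (ex_intro _ M0 oM0).
have oQ k : orth_mx (M0 *m (s k)^T) by apply: orth_mx_mul => //;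
  apply: orth_mx_tr; exact: os.
have cover : [set: MBorel R n] `<=` [set M | ~ orth_mx M] `|`
    \bigcup_k [set M : MBorel R n | U (M0 *m (s k)^T *m M)].
  move=> M _; have [oM|] := pselect (orth_mx M); last by left.
  right; have [k Mk] := s_net M oM; exists k => //=; apply: ball_U.
  have := dist_orth_mulmx_lt (oQ k) r0 Mk.
  by rewrite -[_ *m s k]mulmxA os mulmx1.
have : mu.-negligible [set: MBorel R n].
  apply: negligibleS cover (negligibleU nN (negligible_bigcup _)) => k.
  exact: haar_negligible_translate.
move=> nT; have /eqP := etrans (esym mu1) (measure_negligible measurableT nT).
by rewrite onee_eq0.
Qed.

End HaarMeasure.

Section PolynomialGrowth.
Variables (R : realType) (n : nat).
Implicit Types f g : 'rV[R]_n -> R.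

Lemma derive_sum_pd f x v : differentiable f x ->
  'D_v f x = \sum_i v 0 i * pd i f x.
Proof.
move=> df; rewrite (deriveE v df) {1}(row_sum_delta v) linear_sum.
by apply: eq_bigr => i _; rewrite linearZ/= /pd deriveE.
Qed.

Lemma normr_derive_le f x v : differentiable f x ->
  `|'D_v f x| <= (\sum_i `|v 0 i|) * enorm (grad f x).
Proof.
move=> df; rewrite derive_sum_pd// (le_trans (ler_norm_sum _ _ _))// mulr_suml.
apply: ler_sum => i _; rewrite normrM ler_wpM2l//.
by have := coord_le_enorm (grad f x) i; rewrite mxE.
Qed.

(* exp(s) dominates s^(m+1) / (m+1)!. *)
Lemma poly_le_gaussn m (e : R) : 0 < e -> exists2 K, 0 < K &
  forall x : 'rV[R]_n, 1 + enorm x ^+ m <= K * gaussn (- e) x.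
Proof.
move=> e0; pose a := m.+1`!%:R / e ^+ m.+1; have a0 : 0 < a.
  by rewrite divr_gt0 ?exprn_gt0// ltr0n fact_gt0.
exists (2 + a) => [|x]; first by rewrite addr_gt0.
have s0 : 0 <= e * sqnorm x by rewrite mulr_ge0 ?sqnorm_ge0// ltW.
have gaussnE : gaussn (- e) x = expR (e * sqnorm x)
  by rewrite /gaussn mulNr opprK.
have exp_ge1 : 1 <= gaussn (- e) x by rewrite gaussnE -expR0 ler_expR.
have exp_ge : (sqnorm x) ^+ m.+1 <= a * gaussn (- e) x.
  have := expR_ge1Dxn m s0; rewrite -gaussnE exprMn => exp_ge.
  have {exp_ge}: e ^+ m.+1 * sqnorm x ^+ m.+1 / m.+1`!%:R <= gaussn (- e) x.
    by apply: le_trans exp_ge; rewrite lerDr.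
  rewrite -(ler_pM2l a0) [leLHS](_ : _ = sqnorm x ^+ m.+1)// /a; field.
  by rewrite pnatr_eq0 -lt0n fact_gt0 expf_neq0 // gt_eqF.
have enorm_le : enorm x ^+ m <= 1 + (sqnorm x) ^+ m.+1.
  have [x1|/ltW x1] := leP (enorm x) 1.
    by rewrite (le_trans (exprn_ile1 m (enorm_ge0 x) x1))// lerDl exprn_ge0//
      sqnorm_ge0.
  rewrite -sqr_enorm -exprM (le_trans (ler_weXn2l x1 (_ : m <= 2 * m.+1)%N))//.
    by rewrite mul2n -addnn; rewrite leqW// leq_addr.
  by rewrite lerDr.
by rewrite mulrDl; lra.
Qed.

Lemma gauss_tempered_poly f c m : continuous f ->
  (forall x, `|f x| <= c * (1 + enorm x ^+ m)) -> gauss_tempered f.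
Proof.
move=> cf f_le; have e0 : 0 < 4^-1 :> R by rewrite invr_gt0.
have [K K0 Kle] := poly_le_gaussn m e0.
have c0 : 0 <= c.
  have := le_trans (normr_ge0 _) (f_le 0); rewrite pmulr_lge0//.
  by rewrite ltr_wpDr ?exprn_ge0 ?enorm_ge0.
exists (c * K), (- 4^-1); split; first by rewrite ltrN2; lra.
by split=> // x; rewrite (le_trans (f_le x))// -mulrA ler_wpM2l.
Qed.

Definition gauss_C1 f := [/\ forall x, differentiable f x, gauss_tempered f &
  forall v, gauss_tempered (fun x => 'D_v f x)].

Lemma gauss_C1_poly f c m : (forall x, differentiable f x) ->
  (forall v, continuous (fun x => 'D_v f x)) ->
  (forall x, `|f x| <= c * (1 + enorm x ^+ m)) ->
  (forall x, enorm (grad f x) <= c * (1 + enorm x ^+ m)) -> gauss_C1 f.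
Proof.
move=> df cDf f_le grad_le; split=> // [|v].
  by apply: gauss_tempered_poly f_le => x; exact/differentiable_continuous.
apply: (gauss_tempered_poly (c := (\sum_i `|v 0 i|) * c) (m := m)) => // x.
rewrite (le_trans (normr_derive_le v (df x)))// -mulrA ler_wpM2l//.
exact: sumr_ge0.
Qed.

Lemma gauss_C1B f g : gauss_C1 f -> gauss_C1 g -> gauss_C1 (fun x => f x - g x).
Proof.
move=> [df ft Df_t] [dg gt Dg_t]; split=> [x||v]; first exact: differentiableB.
  exact: gauss_dominatedB.
have -> : (fun x => 'D_v (fun x => f x - g x) x) =
  (fun x => 'D_v f x - 'D_v g x).
  by apply/funext => x; rewrite -deriveB//; exact: diff_derivable.
exact: gauss_dominatedB (Df_t v) (Dg_t v).
Qed.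

Lemma derive_mulmx f (M : 'M[R]_n) v x :
  'D_v (fun z => f (z *m M)) x = 'D_(v *m M) f (x *m M).
Proof.
have quotientE :
    (fun h : R => h^-1 *: (((fun z => f (z *m M)) \o shift x) (h *: v) -
       f (x *m M))) =
    (fun h : R => h^-1 *: ((f \o shift (x *m M)) (h *: (v *m M)) - f (x *m M))).
  by apply/funext => h /=; rewrite mulmxDl -scalemxAl.
by rewrite /derive quotientE.
Qed.

Lemma gauss_dominated_orth a f (M : 'M[R]_n) : orth_mx M ->
  gauss_dominated a f -> gauss_dominated a (fun x => f (x *m M)).
Proof.
move=> oM [C [e [ae [cf fC]]]]; exists C, e; split=> //; split=> x; last first.
  by rewrite (le_trans (fC _))// /gaussn sqnorm_orth.
have := @continuous_affine R 1 n n M 0 x; under eq_fun do rewrite addr0.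
by move=> /continuous_comp; apply; exact: cf.
Qed.

Lemma gauss_C1_orth f (M : 'M[R]_n) : orth_mx M -> gauss_C1 f ->
  gauss_C1 (fun x => f (x *m M)).
Proof.
move=> oM [df ft Df_t]; split=> [x||v]; last 2 first.
- exact: gauss_dominated_orth.
- under eq_fun do rewrite derive_mulmx.
  exact: (gauss_dominated_orth oM (Df_t _)).
apply: (@differentiable_comp _ _ _ _ (mulmxr M) f); last exact: df.
apply: linear_differentiable => y.
by have := @continuous_affine R 1 n n M 0 y; under eq_fun do rewrite addr0.
Qed.

Lemma differentiable_sqnorm x : differentiable (@sqnorm R n) x.
Proof.
have -> : @sqnorm R n = \sum_(i < n) (fun x : 'rV[R]_n => x 0 i) ^+ 2.
  by apply/funext => z; rewrite fct_sumE.
by apply: differentiable_sum => i; apply: differentiableX;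
  exact: differentiable_coord.
Qed.

Lemma is_derive_coord x v i : is_derive x v (fun z : 'rV[R]_n => z 0 i) (v 0 i).
Proof.
apply: DeriveDef; first exact/diff_derivable/differentiable_coord.
apply: cvg_lim => //; apply: cvg_near_cst; near=> h; rewrite /= !mxE addrK.
by rewrite scalerA mulVf ?scale1r//; near: h; exact: nbhs_dnbhs_neq.
Unshelve. all: by end_near. Qed.

Lemma derive_sqnorm v x : 'D_v (@sqnorm R n) x = 2 * dot x v.
Proof.
have dcoord2 i :
  is_derive x v ((fun z : 'rV[R]_n => z 0 i) ^+ 2) (2 * x 0 i * v 0 i).
  have dcoord := is_derive_coord x v i.
  by apply: is_derive_eq; rewrite expr1.
have -> : @sqnorm R n = \sum_(i < n) (fun x : 'rV[R]_n => x 0 i) ^+ 2.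
  by apply/funext => z; rewrite fct_sumE.
rewrite derive_val /dot mxE mulr_sumr.
by apply: eq_bigr => i _; rewrite mxE mulrA.
Qed.

End PolynomialGrowth.

Section LogDensities.
Variables (R : realType) (n : nat).
Implicit Types p : 'rV[R]_n -> R.

Lemma differentiable_ln_comp p x : 0 < p x -> differentiable p x ->
  differentiable (fun z => ln (p z)) x.
Proof.
move=> p0 dp; apply: (@differentiable_comp _ _ _ _ p (@ln R)) => //.
by apply/derivable1_diffP; case: (is_derive1_ln p0).
Qed.

Lemma derive_ln_comp p x v : 0 < p x -> differentiable p x ->
  'D_v (fun z => ln (p z)) x = 'D_v p x / p x.
Proof.
move=> p0 dp; have dln := is_derive1_ln p0.
have dln_diff : differentiable (@ln R) (p x) by apply/derivable1_diffP;
  case: dln.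
rewrite (deriveE v (differentiable_ln_comp p0 dp)) diff_comp//= diff1E//
  -(deriveE v dp).
by rewrite derive1E (@derive_val _ _ _ _ _ _ _ dln).
Qed.

Lemma gauss_C1_ln_dens p c m : (forall x, 0 < p x) ->
  (forall x, differentiable p x) ->
  (forall v, continuous (fun x => 'D_v p x)) ->
  leb_ae (fun x : 'rV[R]_n => `|ln (p x)| <= c * (1 + enorm x ^+ m) /\
    enorm (grad (fun z => ln (p z)) x) <= c * (1 + enorm x ^+ m)) ->
  gauss_C1 (fun x => ln (p x)).
Proof.
move=> p0 dp cDp bounds_ae; have dln x := differentiable_ln_comp (p0 x) (dp x).
have cln : continuous (fun x => ln (p x)) by move=> x;
  exact: differentiable_continuous.
have cDln v : continuous (fun x => 'D_v (fun z => ln (p z)) x).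
  have -> : (fun x => 'D_v (fun z => ln (p z)) x) =
    (fun x => 'D_v p x * (p x)^-1).
    by apply/funext => x; exact: derive_ln_comp.
  move=> x; apply: (@cvgM R _ (nbhs x)); first exact: cDp.
  by apply: cvgV; [rewrite gt_eqF|exact: differentiable_continuous].
have cbound : continuous (fun x : 'rV[R]_n => c * (1 + enorm x ^+ m)).
  move=> x; apply: (@cvgM R _ (nbhs x)); first exact: cvg_cst.
  apply: cvgD; first exact: cvg_cst.
  apply: (@continuous_comp _ _ _ (@enorm R n) (fun t => t ^+ m)).
    exact: continuous_enorm.
  exact: exprn_continuous.
have bounds x : `|ln (p x)| <= c * (1 + enorm x ^+ m) /\
    enorm (grad (fun z => ln (p z)) x) <= c * (1 + enorm x ^+ m).
  apply: leb_ae_closed bounds_ae x; apply: closedI;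
    apply: closed_le_continuous => // x.
    by apply: (@continuous_comp _ _ _ (fun x => ln (p x)) (@Num.norm R R));
      [exact: cln|exact: norm_continuous].
  apply: (@continuous_comp _ _ _ (grad (fun z => ln (p z))) (@enorm R n));
    last exact: continuous_enorm.
  by apply: continuous_mx => i j; under eq_fun do rewrite mxE; exact: cDln.
by apply: (gauss_C1_poly (c := c) (m := m)) => // x; case: (bounds x).
Qed.

Lemma ln_gauss_dens (x : 'rV[R]_n) :
  ln (gauss_dens x) = ln (gauss_peak R n) - sqnorm x / 2.
Proof.
by rewrite gauss_densE lnM ?posrE ?gauss_peak_gt0 ?gaussn_gt0// expRK
  [2^-1 * _]mulrC.
Qed.

Lemma differentiable_ln_gauss_dens (x : 'rV[R]_n) :
  differentiable (fun z => ln (gauss_dens z)) x.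
Proof.
rewrite (funext ln_gauss_dens); apply: differentiableB => //.
by apply: differentiableM => //; exact: differentiable_sqnorm.
Qed.

Lemma derive_ln_gauss_dens v (x : 'rV[R]_n) :
  'D_v (fun z => ln (gauss_dens z)) x = - dot x v.
Proof.
have dsq : is_derive x v (@sqnorm R n) (2 * dot x v).
  apply: DeriveDef; last exact: derive_sqnorm.
  exact/diff_derivable/differentiable_sqnorm.
have -> : (fun z => ln (gauss_dens z)) =
  cst (ln (gauss_peak R n)) - 2^-1 *: @sqnorm R n.
  by apply/funext => z; rewrite ln_gauss_dens mulrC.
rewrite derive_val sub0r; congr (- _).
by rewrite /GRing.scale/=; field.
Qed.

Lemma gauss_C1_ln_gauss_dens : gauss_C1 (fun x : 'rV[R]_n => ln (gauss_dens x)).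
Proof.
have enorm_le (x : 'rV[R]_n) : enorm x <= 1 + enorm x ^+ 2.
  have := sqr_ge0 (enorm x - 1); have := enorm_ge0 x; nra.
pose a : R := `|ln (gauss_peak R n)|; have a0 : 0 <= a by exact: normr_ge0.
apply: (gauss_C1_poly (c := a + 1) (m := 2)) => [x|v|x|x].
- exact: differentiable_ln_gauss_dens.
- under eq_fun do rewrite derive_ln_gauss_dens.
  by move=> x; apply: (@cvgN R R^o _ (nbhs x)); exact: continuous_dot.
- rewrite ln_gauss_dens -sqr_enorm (le_trans (ler_normB _ _))// -/a.
  have x2_ge0 := sqr_ge0 (enorm x).
  by rewrite ger0_norm ?divr_ge0//; nra.
- have -> : grad (fun z => ln (gauss_dens z)) x = - x.
    by apply/rowP => i; rewrite !mxE /pd derive_ln_gauss_dens dot_delta.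
  have -> : enorm (- x) = enorm x
    by rewrite /enorm -scaleN1r sqnormZ sqrrN expr1n mul1r.
  have x2_ge0 := sqr_ge0 (enorm x); have := enorm_le x; nra.
Qed.

Definition log_ratio p (x : 'rV[R]_n) : R := ln (p x) - ln (gauss_dens x).

Lemma gauss_C1_log_ratio p : gauss_C1 (fun x => ln (p x)) ->
  gauss_C1 (log_ratio p).
Proof. by move=> /gauss_C1B; apply; exact: gauss_C1_ln_gauss_dens. Qed.

Lemma log_ratio_rot p (M : 'M[R]_n) : orth_mx M ->
  log_ratio (rot_dens p M) = (fun x => log_ratio p (x *m M)).
Proof.
by move=> oM; apply/funext => x; rewrite /log_ratio /gauss_dens sqnorm_orth.
Qed.

Lemma log_ratio_cst_gauss_dens p k : (forall x, 0 < p x) ->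
  (forall x, log_ratio p x = k) ->
  leb_int (fun x => (p x)%:E) = 1%E -> forall x, p x = gauss_dens x.
Proof.
move=> p0 pk p1.
have pE x : p x = expR k * gauss_dens x.
  by rewrite -(pk x) expRB !lnK ?posrE ?gauss_dens_gt0// divfK// gt_eqF//
    gauss_dens_gt0.
have dens_decay : gauss_decay (fun x : 'rV[R]_n => expR k * gauss_dens x).
  exact: gauss_tempered_decay (gauss_tempered_cst n (expR k)).
move: p1; rewrite (funext pE) leb_int_EFin//.
rewrite -/(gauss_mean (fun=> expR k)) gauss_mean_cst => -[expk] x.
by rewrite expk mul1r.
Qed.

End LogDensities.

Section ProjectedFisherInformation.
Variables (R : realType) (n : nat).
Implicit Type p : 'rV[R]_n.+1 -> R.

Lemma setc_row_cons s (y : 'rV[R]_n) t :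
  setc (row_cons s y) ord0 t = row_cons t y.
Proof.
apply/rowP => j; rewrite mxE; case: (unliftP ord0 j) => [k|] ->.
  by rewrite !row_consS.
by rewrite eqxx row_cons0.
Qed.

Lemma gauss_exp_setc (f : 'rV[R]_n.+1 -> R) t : gauss_tempered f ->
  gauss_exp (fun y => (f (setc y ord0 t))%:E) = (slice_mean f t)%:E.
Proof.
move=> ft; rewrite /gauss_exp /=.
have -> : (fun s => (normal_pdf 0 1 s)%:E * wint (normal_pdf 0 1)
      (fun y : 'rV[R]_n => (f (setc (row_cons s y) ord0 t))%:E))%E =
    (fun s => (normal_pdf 0 1 s)%:E * (slice_mean f t)%:E)%E.
  apply/funext => s; congr (_ * _)%E.
  under [X in wint _ X]eq_fun do rewrite setc_row_cons.
  exact: gauss_exp_EFin (gauss_dominated_slice t ft).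
rewrite integralZr//; last exact: integrable_normal_pdf.
by rewrite integral_normal_pdf mul1e.
Qed.

Lemma pd_log_ratio p i x : differentiable (fun z => ln (p z)) x ->
  pd i (fun z => ln (gauss_dens z)) x - pd i (fun z => ln (p z)) x =
  - pd i (log_ratio p) x.
Proof.
move=> dp; rewrite /pd deriveB ?opprB//; first exact: diff_derivable.
exact/diff_derivable/differentiable_ln_gauss_dens.
Qed.

Lemma proj_fisher_gauss_eq0 p : gauss_C1 (fun x => ln (p x)) ->
  proj_fisher_gauss p = 0%E ->
    forall t, slice_mean (pd ord0 (log_ratio p)) t = 0.
Proof.
move=> p_C1; have [dp _ _] := p_C1; have [_ _ Dg_t] := gauss_C1_log_ratio p_C1.
pose h t := slice_mean (pd ord0 (log_ratio p)) t.
have inner t : gauss_exp (fun y =>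
    (pd ord0 (fun z => ln (gauss_dens z)) (setc y ord0 t) -
     pd ord0 (fun z => ln (p z)) (setc y ord0 t))%:E) = (- h t)%:E.
  under [X in gauss_exp X]eq_fun do rewrite pd_log_ratio// -mulN1r.
  rewrite (gauss_exp_setc t (gauss_dominatedZ (-1) (Dg_t _))) /slice_mean.
  rewrite gauss_meanZ ?mulN1r//.
  exact: gauss_dominated_slice t (Dg_t _).
have w0 (s : R) : 0 < normal_pdf 0 1 s by exact: normal_pdf01_gt0.
have sqr_ge0e (a : \bar R) : (0 <= a * a)%E by rewrite -expe2 sqre_ge0.
rewrite /proj_fisher_gauss => /eqP; rewrite big_ord_recl padde_eq0;
  last 2 first.
- exact: wint_ge0.
- by apply: sume_ge0 => i _; exact: wint_ge0.
move=> /andP[/eqP first_term0 _] t.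
have : h (row_cons t (0 : 'rV[R]_n) 0 ord0) ^+ 2 = 0.
  apply: (wint_continuous_eq0 (@continuous_normal_pdf01 R) w0
    (f := fun x : 'rV[R]_n.+1 => h (x 0 ord0) ^+ 2)) => [x|x|].
  - apply: (@continuous_comp _ _ _ (fun x : 'rV[R]_n.+1 => h (x 0 ord0))
      (fun t => t ^+ 2)).
      apply: (@continuous_comp _ _ _ (fun x : 'rV[R]_n.+1 => x 0 ord0) h).
        exact: coord_continuous.
      exact: continuous_slice_mean (Dg_t _) _.
    exact: exprn_continuous.
  - exact: sqr_ge0.
  - rewrite -[RHS]first_term0; congr wint; apply/funext => x.
    by rewrite inner -EFinM mulrNN expr2.
by rewrite row_cons0 => /eqP; rewrite sqrf_eq0 => /eqP.
Qed.

End ProjectedFisherInformation.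

Section VanishingProjectedFisherInformation.
Variables (R : realType) (n : nat) (p : 'rV[R]_n.+1 -> R).
Hypothesis ln_p_C1 : gauss_C1 (fun x => ln (p x)).

Let centered_log_ratio x := log_ratio p x - gauss_mean (log_ratio p).

Let centered_tempered : gauss_tempered centered_log_ratio.
Proof.
have [_ g_temp _] := gauss_C1_log_ratio ln_p_C1.
exact: gauss_dominatedB g_temp (gauss_tempered_cst _ _).
Qed.

Lemma gauss_mean_cos_row0 (M : 'M[R]_n.+1) s b : orth_mx M ->
  proj_fisher_gauss (rot_dens p M) = 0%E ->
  gauss_mean (fun x => centered_log_ratio x * cos (dot x (s *: row 0 M) + b)) =
    0.
Proof.
move=> oM fisher0.
have rot_C1 : gauss_C1 (fun x => ln (rot_dens p M x)) :=
  gauss_C1_orth oM ln_p_C1.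
have [dg g_temp Dg_temp] := gauss_C1_log_ratio rot_C1.
have mean_rot :
  gauss_mean (log_ratio (rot_dens p M)) = gauss_mean (log_ratio p).
  have [_ p_temp _] := gauss_C1_log_ratio ln_p_C1.
  by rewrite (log_ratio_rot p oM) (gauss_mean_orth oM p_temp).
have derg x : derivable (log_ratio (rot_dens p M)) x (delta_mx 0 ord0).
  exact: diff_derivable.
have := gauss_mean_ridge_orthogonal (fun t => cos (s * t + b))
  derg g_temp (Dg_temp _) (proj_fisher_gauss_eq0 rot_C1 fisher0).
rewrite mean_rot (log_ratio_rot p oM) => <-.
rewrite -(gauss_mean_orth oM (gauss_tempered_mul_cos _ _ centered_tempered)).
apply: eq_gauss_mean => x.
by rewrite dotZr rowE dot_orth// dot_delta.
Qed.

Variable mu : {measure set (MBorel R n.+1) -> \bar R}.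
Hypothesis mu_haar : is_haar_On mu.
Hypothesis fisher_ae : {ae mu, forall M : MBorel R n.+1,
  orth_mx M -> proj_fisher_gauss (rot_dens p M) = 0%E}.

Lemma cos_orthogonal_log_ratio : cos_orthogonal centered_log_ratio.
Proof.
move=> w b; have [s [M0 oM0 ->]] := rV_scale_orth_row0 w.
have [M_ M_P M_cvg] := closure_sequence (haar_ae_dense mu_haar fisher_ae oM0).
have mean0 k : gauss_mean (fun x =>
    centered_log_ratio x * cos (dot x (s *: row 0 (M_ k)) + b)) = 0.
  by have [oM fisher0] := M_P k; exact/gauss_mean_cos_row0/fisher0.
have w_cvg : s *: row 0 (M_ k) @[k --> \oo] --> s *: row 0 M0.
  apply: cvg_mx => i j; rewrite !mxE; under eq_fun do rewrite !mxE.
  by apply: cvgM; [exact: cvg_cst|exact: cvg_mx_coord M_cvg].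
have := cvg_gauss_mean_cos (b := b) centered_tempered w_cvg.
by under eq_fun do rewrite mean0; exact: cvgn_cst_eq.
Qed.

Lemma log_ratio_cst x : log_ratio p x = gauss_mean (log_ratio p).
Proof.
apply/eqP; rewrite -subr_eq0; apply/eqP.
exact: cos_orthogonal_eq0 centered_tempered cos_orthogonal_log_ratio x.
Qed.

End VanishingProjectedFisherInformation.

Theorem theorem1 (R : realType) (d : nat) (p : 'rV[R]_d -> R)
  (mu : {measure set (MBorel R d) -> \bar R}) :
  (* standing assumptions on p *)
  (forall x, 0 < p x) ->
  (forall x, differentiable p x) ->
  (forall v : 'rV[R]_d, continuous (fun x => 'D_v p x)) ->
  leb_int (fun x => (p x)%:E) = 1%E ->
  (exists (c : R) (m : nat), 0 < c /\ (2 <= m)%N /\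
     leb_ae (fun x : 'rV[R]_d =>
       `|ln (p x)| <= c * (1 + enorm x ^+ m) /\
       enorm (grad (fun z => ln (p z)) x) <= c * (1 + enorm x ^+ m))) ->
  (* mu is the Haar measure of O(d) *)
  is_haar_On mu ->
  (* tI(gamma, p_R) = 0 for mu-almost every orth_mx R *)
  {ae mu, forall Rm : MBorel R d,
     orth_mx Rm -> proj_fisher_gauss (rot_dens p Rm) = 0%E} ->
  forall x, p x = gauss_dens x.
Proof.
case: d p mu => [|n] p mu p_gt0 p_diff p_C1 p_mass.
  move=> _ _ _ x; rewrite gauss_dens_rV0 (_ : x = 0); last by apply/rowP => -[].
  by case: p_mass.
move=> [c [m [_ [_ bounds_ae]]]] haar fisher_ae.
have ln_p_C1 := gauss_C1_ln_dens p_gt0 p_diff p_C1 bounds_ae.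
have log_ratio_cst := log_ratio_cst ln_p_C1 haar fisher_ae.
exact: log_ratio_cst_gauss_dens p_gt0 log_ratio_cst p_mass.
Qed.
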